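(* Let $k$ be an infinite field and $G$ a finite group. For any $G$-lattice $M$ below, $G$ acts on $k(M)$ by purely monomial $k$-automorphisms. The following statements are equivalent: (i) $k(G)$ is retract $k$-rational; (ii) $k(M)^G$ is retract $k$-rational for some faithful permutation $G$-lattice $M$; (iii) $k(M)^G$ is retract $k$-rational for some faithful $G$-lattice $M$ such that $[M]^{fl}$ is invertible; (iv) $k(M)^G$ is retract $k$-rational for all faithful permutation $G$-lattices $M$; (v) $k(M)^G$ is retract $k$-rational for all faithful $G$-lattices $M$ such that $[M]^{fl}$ is invertible; (vi) $k(M)^G$ is retract $k$-rational for some faithful $G$-lattice $M$.
   Context: A $G$-lattice is a finitely generated $\mathbb{Z}[G]$-module that is free as an abelian group; it is faithful if $G$ acts faithfully on it. It is a permutation lattice if it has a $\mathbb{Z}$-basis permuted by $G$, invertible if it is a direct summand (as a $\mathbb{Z}[G]$-module) of a permutation lattice, and flabby if $H^{-1}(G',M)=0$ (Tate cohomology) for every subgroup $G'\subset G$. Flabby class: two $G$-lattices satisfy $M_1\sim M_2$ if $M_1\oplus Q_1\simeq M_2\oplus Q_2$ for some permutation lattices $Q_1,Q_2$; $[M]$ is the similarity class of $M$. Every $G$-lattice $M$ has a flabby resolution, an exact sequence $0\to M\to P\to F\to 0$ of $G$-lattices with $P$ permutation and $F$ flabby; the flabby class $[M]^{fl}:=[F]$ is well defined. ''$[M]^{fl}$ is invertible'' means $[M]^{fl}=[E]$ for some invertible lattice $E$. The field $k(M)^G$: if $M=\bigoplus_{1\le i\le m}\mathbb{Z}\cdot x_i$,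 then $k(M)=k(x_1,\ldots,x_m)$ is the rational function field, on which $G$ acts by (purely monomial) $k$-automorphisms, trivially on $k$: if $\sigma\cdot x_j=\sum_i a_{ij}x_i$ in $M$ then $\sigma\cdot x_j=\prod_i x_i^{a_{ij}}$ in $k(M)$. $k(M)^G$ is the fixed field. $k(G)=k(x_g:g\in G)^G$ where $G$ acts on the rational function field $k(x_g:g\in G)$ by $k$-automorphisms with $h\cdot x_g=x_{hg}$. Retract rationality: a field $L\supset k$ ($k$ infinite) is called retract $k$-rational if there are an affine domain $A$ over $k$ (an integral domain finitely generated as a $k$-algebra), a polynomial ring $k[X_1,\ldots,X_n]$, a nonzero $f\in k[X_1,\ldots,X_n]$, and $k$-algebra morphisms $\varphi:A\to k[X_1,\ldots,X_n][1/f]$ and $\psi:k[X_1,\ldots,X_n][1/f]\to A$ such that (i) $L$ is the quotient field of $A$, and (ii) $\psi\circ\varphi=1_A$. *)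

(* Defs.v *)
From HB Require Import structures.
From mathcomp Require Import all_boot all_order all_algebra all_fingroup.
From mathcomp Require Import all_character boolp.
From mathcomp.multinomials Require Import mpoly.

Set Implicit Arguments.
Unset Strict Implicit.
Unset Printing Implicit Defensive.

Import Order.TTheory GRing.Theory Num.Theory.
Local Open Scope ring_scope.

(* [repr] alone would be the set representative of fingroup. *)
Local Notation quorepr := generic_quotient.repr.

Section RationalFunctions.

Variables (k : fieldType) (n : nat).

Definition ratfun : fieldType := {fraction {mpoly k[n]}}.

Definition rfP : {mpoly k[n]} -> ratfun := @FracField.tofrac {mpoly k[n]}.
Definition rfC : k -> ratfun := rfP \o @mpolyC n k.
Definition rfX (i : 'I_n) : ratfun := rfP 'X_i.

HB.instance Definition _ :=
  GRing.RMorphism.copy rfP (@FracField.tofrac {mpoly k[n]}).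
HB.instance Definition _ := GRing.RMorphism.copy rfC (rfP \o @mpolyC n k).

Lemma rfP_eq0 p : (rfP p == 0) = (p == 0).
Proof. exact: tofrac_eq0. Qed.

Lemma ratfunE (z : ratfun) : z = rfP \n_(quorepr z) / rfP \d_(quorepr z).
Proof.
rewrite /rfP; set r : {ratio _} := quorepr z.
have d0 : rfP \d_r != 0 by rewrite rfP_eq0 denom_ratioP.
apply: (mulIf d0); rewrite mulfVK // -[z in LHS](reprK z) -/r /rfP.
unlock FracField.tofrac; rewrite -[LHS]FracField.pi_mul.
apply/eqmodP; rewrite /= FracField.equivfE /FracField.mulf.
by rewrite !numden_Ratio ?mulf_neq0 ?oner_neq0 ?denom_ratioP // !mulr1 mulrC.
Qed.

Implicit Type h : 'I_n -> ratfun.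

Definition rf_eval h : {mpoly k[n]} -> ratfun := mmap rfC h.
HB.instance Definition _ h := GRing.RMorphism.copy (rf_eval h) (mmap rfC h).

(* p / q |-> p(h_0, ..., h_(n-1)) / q(h_0, ..., h_(n-1)); this is the         *)
(* k-endomorphism x_i |-> h_i when the h_i are algebraically independent.     *)
Definition rf_subst h (z : ratfun) : ratfun :=
  rf_eval h \n_(quorepr z) / rf_eval h \d_(quorepr z).

Definition alg_indep h := forall p, rf_eval h p = 0 -> p = 0.

Section Subst.

Variables (h : 'I_n -> ratfun) (h_free : alg_indep h).

Lemma rf_eval_neq0 p : p != 0 -> rf_eval h p != 0.
Proof. by apply: contraNneq => /h_free->. Qed.

Lemma rf_subst_frac p q :
  q != 0 -> rf_subst h (rfP p / rfP q) = rf_eval h p / rf_eval h q.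
Proof.
move=> q0; rewrite /rf_subst; set r : {ratio _} := quorepr _.
have d0 : \d_r != 0 by rewrite denom_ratioP.
have := ratfunE (rfP p / rfP q); rewrite -/r => /eqP.
rewrite eqr_div ?rfP_eq0 // -!rmorphM /= /rfP tofrac_eq => /eqP e.
by apply/eqP; rewrite eqr_div ?rf_eval_neq0 // -!rmorphM /= e.
Qed.

Lemma rf_subst_sub : {morph rf_subst h : y z / y - z}.
Proof.
move=> y z; rewrite (ratfunE y) (ratfunE z).
move: (denom_ratioP (quorepr y)) (denom_ratioP (quorepr z)).
move: (\n__) (\d__) (\n__) (\d__) => a b c d b0 d0.
rewrite -mulNr addf_div ?rfP_eq0 // -rmorphN -!rmorphM -rmorphD.
rewrite !rf_subst_frac ?mulf_neq0 // -mulNr addf_div ?rf_eval_neq0 //.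
by rewrite -rmorphN -!rmorphM -rmorphD.
Qed.

Lemma rf_subst_mul : {morph rf_subst h : y z / y * z}.
Proof.
move=> y z; rewrite (ratfunE y) (ratfunE z).
move: (denom_ratioP (quorepr y)) (denom_ratioP (quorepr z)).
move: (\n__) (\d__) (\n__) (\d__) => a b c d b0 d0.
rewrite mulf_div -!rmorphM !rf_subst_frac ?mulf_neq0 //.
by rewrite mulf_div -!rmorphM.
Qed.

Lemma rf_subst_poly p : rf_subst h (rfP p) = rf_eval h p.
Proof.
rewrite -[rfP p]divr1 -(rmorph1 rfP) rf_subst_frac ?oner_neq0 //.
by rewrite rmorph1 divr1.
Qed.

Lemma rf_substC c : rf_subst h (rfC c) = rfC c.
Proof. by rewrite rf_subst_poly /rf_eval mmapC. Qed.

Lemma rf_substX i : rf_subst h (rfX i) = h i.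
Proof. by rewrite rf_subst_poly /rf_eval mmapX mmap1U. Qed.

Lemma rf_subst1 : rf_subst h 1 = 1.
Proof. by rewrite -(rmorph1 rfC) rf_substC. Qed.

Lemma rf_substV : {morph rf_subst h : z / z^-1}.
Proof.
move=> z; have [->|z0] := eqVneq z 0.
  by rewrite invr0 -[0](subrr 0) rf_subst_sub subrr invr0.
have zV : rf_subst h z * rf_subst h z^-1 = 1.
  by rewrite -rf_subst_mul (divff z0) rf_subst1.
have nz : rf_subst h z != 0.
  by apply: contra_eq_neq zV => ->; rewrite mul0r eq_sym oner_neq0.
by rewrite -[RHS]mulr1 -zV (mulKf nz).
Qed.

Lemma rf_subst_prod I (r : seq I) (F : I -> ratfun) :
  rf_subst h (\prod_(i <- r) F i) = \prod_(i <- r) rf_subst h (F i).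
Proof. exact: (big_morph _ rf_subst_mul rf_subst1). Qed.

Lemma rf_substXz z (m : int) : rf_subst h (z ^ m) = rf_subst h z ^ m.
Proof.
have Xn i : rf_subst h (z ^+ i) = rf_subst h z ^+ i.
  by elim: i => [|i IHi]; rewrite ?rf_subst1 // !exprS rf_subst_mul IHi.
by case: m => i; [exact: Xn | rewrite !NegzE -!exprnN rf_substV Xn].
Qed.

End Subst.
End RationalFunctions.

(* An action of G on k(x_0, ..., x_(n-1)) by k-automorphisms, given by the    *)
(* images g . x_i of the variables.                                           *)
Record rf_action (gT : finGroupType) (G : {group gT}) (k : fieldType) n :=
  RfAction {
    rf_image :> gT -> 'I_n -> ratfun k n;
    rf_image_free : {in G, forall g, alg_indep (rf_image g)};
    rf_image1 : rf_image 1%g =1 rfX k (n := n);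
    rf_imageM : {in G &, forall g h i,
      rf_image (g * h)%g i = rf_subst (rf_image g) (rf_image h i)} }.

Section FixedField.

Variables (gT : finGroupType) (G : {group gT}) (k : fieldType) (n : nat).
Variable a : rf_action G k n.

Definition rf_fixed : {pred ratfun k n} :=
  fun z => [forall g in G, rf_subst (a g) z == z].

Lemma rf_fixedP z :
  reflect {in G, forall g, rf_subst (a g) z = z} (z \in rf_fixed).
Proof.
apply: (iffP forallP) => [fz g Gg | fz g]; last by apply/implyP=> Gg; rewrite fz.
by apply/eqP; move: (fz g); rewrite Gg.
Qed.

Lemma rf_fixed_divring_closed : divring_closed rf_fixed.
Proof.
split=> [|y z /rf_fixedP fy /rf_fixedP fz|y z /rf_fixedP fy /rf_fixedP fz];
    apply/rf_fixedP => g Gg; have free := rf_image_free (r := a) Gg.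
- exact: rf_subst1.
- by rewrite rf_subst_sub // fy // fz.
- by rewrite rf_subst_mul // rf_substV // fy // fz.
Qed.

HB.instance Definition _ :=
  GRing.isDivringClosed.Build _ rf_fixed rf_fixed_divring_closed.

Record fixed_field :=
  FixedField { fixed_val :> ratfun k n; _ : fixed_val \in rf_fixed }.

HB.instance Definition _ := [isSub for fixed_val].
HB.instance Definition _ := [Choice of fixed_field by <:].
HB.instance Definition _ := [SubChoice_isSubComNzRing of fixed_field by <:].

Lemma fixed_inv_subproof (u : fixed_field) : (val u)^-1 \in rf_fixed.
Proof. by rewrite rpredV; case: u. Qed.
Definition fixed_inv u : fixed_field := FixedField (fixed_inv_subproof u).

Lemma fixed_mulVf u : u != 0 -> fixed_inv u * u = 1.
Proof.
move=> u0; apply: val_inj; rewrite rmorphM rmorph1 /=.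
have vu0 : val u != 0 by apply: contra_neq u0 => v0; apply: val_inj.
exact: (mulVf vu0).
Qed.
Lemma fixed_inv0 : fixed_inv 0 = 0.
Proof. by apply: val_inj; exact: invr0. Qed.

HB.instance Definition _ :=
  GRing.ComNzRing_isField.Build fixed_field fixed_mulVf fixed_inv0.

Lemma rfC_fixed c : rfC n c \in rf_fixed.
Proof. by apply/rf_fixedP => g Gg; rewrite rf_substC //; apply: rf_image_free. Qed.

Definition fixedC c : fixed_field := FixedField (rfC_fixed c).

Lemma fixedC_is_zmod_morphism : zmod_morphism fixedC.
Proof. by move=> c d; apply: val_inj; rewrite /= rmorphB. Qed.
Lemma fixedC_is_monoid_morphism : monoid_morphism fixedC.
Proof.
by split=> [|c d]; apply: val_inj; [rewrite /= rmorph1 | rewrite /= rmorphM].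
Qed.

HB.instance Definition _ :=
  GRing.isZmodMorphism.Build k fixed_field fixedC fixedC_is_zmod_morphism.
HB.instance Definition _ :=
  GRing.isMonoidMorphism.Build k fixed_field fixedC fixedC_is_monoid_morphism.

End FixedField.

(* The localization k[x_0, ..., x_(n-1)][1 / f], for f != 0, inside           *)
(* k(x_0, ..., x_(n-1)).                                                      *)
Section Localization.

Variables (k : fieldType) (n : nat) (f : {mpoly k[n]}).

Definition mploc_pred : {pred ratfun k n} :=
  fun z => `[< exists (p : {mpoly k[n]}) (m : nat), z = rfP p / rfP f ^+ m >].

Lemma mploc_subring_closed : subring_closed mploc_pred.
Proof.
have [f0|f0] := eqVneq f 0.
  have mplocE z : z \in mploc_pred <-> exists p, z = rfP p.
    split=> [/asboolP[p [[|m] ->]] | [p ->]]; last first.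
    - by apply/asboolP; exists p, 0; rewrite expr0 divr1.
    - by exists 0; rewrite f0 rmorph0 exprS mul0r invr0 mulr0.
    - by exists p; rewrite expr0 divr1.
  split=> [|y z /mplocE[p ->] /mplocE[q ->]|y z /mplocE[p ->] /mplocE[q ->]];
    apply/mplocE; first by exists 1; rewrite rmorph1.
    by exists (p - q); rewrite rmorphB.
  by exists (p * q); rewrite rmorphM.
have Ff0 m : rfP f ^+ m != 0 by rewrite expf_neq0 // rfP_eq0.
split=> [|y z /asboolP[p [m ->]] /asboolP[q [l ->]]
         |y z /asboolP[p [m ->]] /asboolP[q [l ->]]]; apply/asboolP.
- by exists 1, 0; rewrite expr0 divr1 rmorph1.
- exists (p * f ^+ l - q * f ^+ m), (m + l)%N.
  by rewrite -mulNr addf_div // exprD rmorphB !rmorphM !rmorphXn mulNr.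
- by exists (p * q), (m + l)%N; rewrite mulf_div exprD rmorphM.
Qed.

HB.instance Definition _ :=
  GRing.isSubringClosed.Build _ mploc_pred mploc_subring_closed.

Record mploc := MpLoc { mploc_val :> ratfun k n; _ : mploc_val \in mploc_pred }.

HB.instance Definition _ := [isSub for mploc_val].
HB.instance Definition _ := [Choice of mploc by <:].
HB.instance Definition _ := [SubChoice_isSubComNzRing of mploc by <:].

Lemma rfC_mploc c : rfC n c \in mploc_pred.
Proof. by apply/asboolP; exists c%:MP, 0; rewrite expr0 divr1. Qed.

Definition mplocC c : mploc := MpLoc (rfC_mploc c).

End Localization.

Definition infinite_field (k : fieldType) : Prop :=
  forall s : seq k, exists x, x \notin s.

(* A k-algebra is a ring equipped with a ring morphism from k.                *)
Definition finitely_generated (k : fieldType) (A : comNzRingType)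
    (iA : {rmorphism k -> A}) : Prop :=
  exists (m : nat) (a : 'I_m -> A),
    forall x, exists p : {mpoly k[m]}, x = mmap iA a p.

Definition retract_rational (k L : fieldType) (iL : {rmorphism k -> L}) : Prop :=
  exists (A : idomainType) (iA : {rmorphism k -> A}) (j : {rmorphism A -> L}),
  [/\ finitely_generated iA,
      injective j /\ (forall c, j (iA c) = iL c),
      (forall z : L, exists a b : A, b != 0 /\ z = j a / j b)
    & exists (n : nat) (f : {mpoly k[n]})
             (phi : {rmorphism A -> mploc f}) (psi : {rmorphism mploc f -> A}),
        [/\ f != 0,
            forall c, phi (iA c) = mplocC f c,
            forall c, psi (mplocC f c) = iA c
          & cancel phi psi]].

Section Monomial.

Variables (k : fieldType) (n : nat).

Definition rf_monomial (v : 'cV[int]_n) : ratfun k n :=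
  \prod_(i < n) rfX k i ^ v i 0.

Lemma rfX_neq0 (i : 'I_n) : rfX k i != 0.
Proof.
rewrite rfP_eq0; apply/eqP => /(congr1 (mcoeff U_(i))) /eqP.
by rewrite mcoeffX eqxx mcoeff0 oner_eq0.
Qed.

Lemma rf_monomialD u v :
  rf_monomial (u + v) = rf_monomial u * rf_monomial v.
Proof.
rewrite -big_split; apply: eq_bigr => i _.
by rewrite mxE expfzDr ?rfX_neq0.
Qed.

Lemma rf_monomial_nat (m : 'X_{1..n}) (v : 'cV[int]_n) :
  (forall i, v i 0 = m i) -> rf_monomial v = rfP 'X_[m].
Proof.
move=> vm; rewrite mpolyXE_id rmorph_prod; apply: eq_bigr => i _.
by rewrite vm rmorphXn.
Qed.

Lemma rf_monomial_mulmx (A : 'M[int]_n) (m : 'X_{1..n}) :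
  mmap1 (fun j => rf_monomial (col j A)) m
    = rf_monomial (A *m \col_i (m i : int)).
Proof.
rewrite /mmap1 /rf_monomial.
under eq_bigr => j _ do rewrite -prodrXl.
rewrite exchange_big; apply: eq_bigr => i _ /=.
rewrite mxE; elim/big_rec2: _ => [|j x y _ ->]; first by rewrite expr0z.
by rewrite expfzDr ?rfX_neq0 // !mxE exprnP exprz_exp.
Qed.

Lemma alg_indep_monomial (A B : 'M[int]_n) :
  B *m A = 1%:M -> alg_indep (fun j => rf_monomial (col j A)).
Proof.
move=> BA p p0.
pose v (m : 'X_{1..n}) : 'cV[int]_n := \col_i (m i : int).
pose N := (\sum_(m <- msupp p) \sum_i absz ((A *m v m) i ord0))%N.
pose w : 'cV[int]_n := const_mx N%:Z.
pose t (m : 'X_{1..n}) := [multinom absz ((A *m v m + w)%R i ord0) | i < n].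
have tE m : m \in msupp p -> forall i, (A *m v m + w) i 0 = t m i.
  move=> mp i; rewrite mnmE gez0_abs // mxE [w i _]mxE.
  have : (absz ((A *m v m) i ord0) <= N)%N.
    rewrite /N (big_rem m) //= (bigD1 i) //= -!addnA; exact: leq_addr.
  move: ((A *m v m) i ord0) => z zN.
  by rewrite -lerBlDl sub0r; apply: le_trans (ler_norm _) _; rewrite normrN.
have t_inj m1 m2 : m1 \in msupp p -> m2 \in msupp p -> t m1 = t m2 -> m1 = m2.
  move=> m1p m2p t12; have : A *m v m1 = A *m v m2.
    apply: (addIr w); apply/matrixP => i j; rewrite ord1 (tE m1) // (tE m2) //.
    by rewrite t12.
  move/(congr1 (mulmx B)); rewrite !mulmxA BA !mul1mx => /matrixP v12.
  by apply/mnmP => i; have := v12 i 0; rewrite !mxE => -[].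
have q0 : \sum_(m <- msupp p) p@_m *: 'X_[t m] = 0 :> {mpoly k[n]}.
  apply/eqP; rewrite -rfP_eq0 rmorph_sum /= big_seq.
  have := congr1 ( *%R^~ (rf_monomial w)) p0.
  rewrite mul0r /rf_eval /mmap mulr_suml big_seq => {2}<-.
  apply/eqP/eq_bigr => m mp; rewrite rf_monomial_mulmx -mulrA -rf_monomialD.
  by rewrite (rf_monomial_nat (tE m mp)) -mul_mpolyC rmorphM.
apply/mpolyP => m0; rewrite mcoeff0; have [m0p|] := boolP (m0 \in msupp p).
  have := congr1 (mcoeff (t m0)) q0; rewrite mcoeff0 raddf_sum /= => <-.
  rewrite (big_rem m0) //= mcoeffZ mcoeffX eqxx mulr1 big_seq big1 ?addr0 //.
  move=> m; rewrite mem_rem_uniq ?msupp_uniq // inE => /andP[m_m0 mp].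
  rewrite mcoeffZ mcoeffX; case: eqP => [/t_inj e|_]; last by rewrite mulr0.
  by rewrite e ?eqxx in m_m0.
exact: memN_msupp_eq0.
Qed.

Lemma alg_indep_perm (s : 'S_n) : alg_indep (fun j => rfX k (s j)).
Proof.
move=> p p0; apply: (inj_msym s); rewrite msym0.
apply/eqP; rewrite -rfP_eq0 -[X in _ == X]p0 rmorph_sum /=.
apply/eqP/eq_bigr => m _; rewrite rmorphM /mmap1 rmorph_prod.
by congr (_ * _); apply: eq_bigr => i _; rewrite rmorphXn.
Qed.

End Monomial.

(* k(G): the variable x_g, for g in G, is the variable of index               *)
(* [gring_index G g] in k(x_0, ..., x_(#|G| - 1)), and h . x_g = x_(h * g).   *)
Section RegularAction.

Variables (k : fieldType) (gT : finGroupType) (G : {group gT}).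

Definition regular_image (h : gT) (j : 'I_#|G|) : ratfun k #|G| :=
  rfX k (gring_index G (h * enum_val j)%g).

Lemma regular_image_free : {in G, forall h, alg_indep (regular_image h)}.
Proof.
move=> h Gh.
have inj : injective (fun j : 'I_#|G| => gring_index G (h * enum_val j)%g).
  move=> i j; move/(congr1 enum_val).
  by rewrite !gring_indexK ?groupM ?enum_valP // => /mulgI/enum_val_inj.
have -> : regular_image h = (fun j => rfX k (perm inj j));
  last exact: alg_indep_perm.
by apply/funext => j; rewrite permE.
Qed.

Lemma regular_image1 : regular_image 1%g =1 rfX k (n := #|G|).
Proof. by move=> j; rewrite /regular_image mul1g gring_valK. Qed.

Lemma regular_imageM : {in G &, forall g h j,
  regular_image (g * h)%g j = rf_subst (regular_image g) (regular_image h j)}.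
Proof.
move=> g h Gg Gh j; rewrite rf_substX; last exact: regular_image_free.
by rewrite /regular_image gring_indexK ?groupM ?enum_valP // mulgA.
Qed.

Definition regular_action : rf_action G k #|G| :=
  RfAction regular_image_free regular_image1 regular_imageM.

End RegularAction.

(* A G-lattice with a chosen Z-basis x_0, ..., x_(n-1) is the module Z^n of   *)
(* column vectors on which g acts as left multiplication by the matrix        *)
(* (a_ij) = rM g, so that g . x_j = \sum_i a_ij x_i.                          *)
Notation glattice G n := (mx_representation int G n).

Section MonomialAction.

Variables (k : fieldType) (gT : finGroupType) (G : {group gT}) (n : nat).
Variable rM : glattice G n.

Definition lattice_image (g : gT) (j : 'I_n) : ratfun k n :=
  rf_monomial k (col j (rM g)).

Lemma lattice_image_free : {in G, forall g, alg_indep (lattice_image g)}.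
Proof.
move=> g Gg; apply: (@alg_indep_monomial k n (rM g) (rM g^-1%g)).
by rewrite -repr_mxM ?groupV // mulVg repr_mx1.
Qed.

Lemma lattice_image1 : lattice_image 1%g =1 rfX k (n := n).
Proof.
move=> j; rewrite /lattice_image repr_mx1 /rf_monomial (bigD1 j) //=.
rewrite !mxE eqxx expr1z big1 ?mulr1 // => i /negPf ij.
by rewrite !mxE ij expr0z.
Qed.

Lemma lattice_imageM : {in G &, forall g h j,
  lattice_image (g * h)%g j = rf_subst (lattice_image g) (lattice_image h j)}.
Proof.
move=> g h Gg Gh j; have free := lattice_image_free Gg.
have expz_prod (r : seq 'I_n) (F : 'I_n -> ratfun k n) (z : int) :
    (\prod_(l <- r) F l) ^ z = \prod_(l <- r) F l ^ z.
  exact: (big_morph (fun x => x ^ z) (fun x y => expfzMl x y z) (exp1rz _ z)).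
rewrite /lattice_image repr_mxM // {2}/rf_monomial rf_subst_prod //.
under eq_bigr => i _ do
  rewrite rf_substXz // rf_substX // expz_prod.
rewrite exchange_big; apply: eq_bigr => l _ /=.
rewrite !mxE; elim/big_rec2: _ => [|i x y _ <-]; first by rewrite expr0z.
by rewrite expfzDr ?rfX_neq0 // !mxE exprz_exp.
Qed.

Definition lattice_action : rf_action G k n :=
  RfAction lattice_image_free lattice_image1 lattice_imageM.

End MonomialAction.

Definition retract_rational_regular (k : fieldType) (gT : finGroupType)
    (G : {group gT}) : Prop :=
  retract_rational (fixedC (regular_action k G)).

Definition retract_rational_lattice (k : fieldType) (gT : finGroupType)
    (G : {group gT}) n (rM : glattice G n) : Prop :=
  retract_rational (fixedC (lattice_action k rM)).

Section Lattices.

Variables (gT : finGroupType) (G : {group gT}).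

Definition lattice_hom m n (rM : glattice G m) (rN : glattice G n)
    (u : 'M[int]_(n, m)) : Prop :=
  {in G, forall g, u *m rM g = rN g *m u}.

Definition lattice_iso m n (rM : glattice G m) (rN : glattice G n) : Prop :=
  exists (u : 'M[int]_(n, m)) (v : 'M[int]_(m, n)),
    [/\ lattice_hom rM rN u, u *m v = 1%:M & v *m u = 1%:M].

Section DirectSum.

Variables (m n : nat) (rM : glattice G m) (rN : glattice G n).

Definition dsum_mx (g : gT) : 'M[int]_(m + n) := block_mx (rM g) 0 0 (rN g).

Lemma dsum_mx_repr : mx_repr G dsum_mx.
Proof.
split=> [|x y Gx Gy]; first by rewrite /dsum_mx !repr_mx1 -scalar_mx_block.
rewrite /dsum_mx mulmx_block !repr_mxM //.
by rewrite !(mulmx0, mul0mx, addr0, add0r).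
Qed.

Definition lattice_dsum : glattice G (m + n) := MxRepresentation dsum_mx_repr.

End DirectSum.

(* The columns of b form the permuted Z-basis.                                *)
Definition permutation_lattice n (rM : glattice G n) : Prop :=
  exists2 b : 'M[int]_n, b \in unitmx &
    {in G, forall g, forall j, exists j', rM g *m col j b = col j' b}.

Definition invertible_lattice m (rM : glattice G m) : Prop :=
  exists n (rN : glattice G n) p (rP : glattice G p),
    permutation_lattice rP /\ lattice_iso (lattice_dsum rM rN) rP.

(* The Tate group H^-1(H, M) is the kernel of the norm \sum_(h in H) h on M   *)
(* modulo the subgroup generated by the h v - v for h in H and v in M, i.e.,  *)
(* the set of all \sum_(h in H) (h (w h) - w h) for w : H -> M.               *)
Definition flabby_lattice n (rM : glattice G n) : Prop :=
  forall (H : {group gT}) (v : 'cV[int]_n), H \subset G ->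
    \sum_(h in H) rM h *m v = 0 ->
    exists w : gT -> 'cV[int]_n, v = \sum_(h in H) (rM h *m w h - w h).

Definition lattice_similar m n (rM : glattice G m) (rN : glattice G n) : Prop :=
  exists p (rP : glattice G p) q (rQ : glattice G q),
    [/\ permutation_lattice rP, permutation_lattice rQ
      & lattice_iso (lattice_dsum rM rP) (lattice_dsum rN rQ)].

Definition flabby_resolution m p f
    (rM : glattice G m) (rP : glattice G p) (rF : glattice G f) : Prop :=
  [/\ permutation_lattice rP, flabby_lattice rF
    & exists (i : 'M[int]_(p, m)) (e : 'M[int]_(f, p)),
        [/\ lattice_hom rM rP i /\ lattice_hom rP rF e,
            injective (fun v : 'cV[int]_m => i *m v),
            forall v : 'cV[int]_p, e *m v = 0 <-> exists u, v = i *m u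
          & forall w : 'cV[int]_f, exists v, w = e *m v]].

Definition flabby_class_invertible m (rM : glattice G m) : Prop :=
  exists p (rP : glattice G p) f (rF : glattice G f) e (rE : glattice G e),
    [/\ flabby_resolution rM rP rF, invertible_lattice rE
      & lattice_similar rF rE].

End Lattices.

(* Main.v *)
(* Say that L/k has a residue section when some local ring of an affine space *)
(* over k has residue field L and contains a copy of L mapping isomorphically *)
(* onto it. This is equivalent to retract rationality, and relative versions  *)
(* over intermediate fields compose.                                          *)
(*   Let A be a faithful lattice with k(A)^G retract rational and let M be    *)
(* faithful with [M]^fl invertible, 0 -> M -> P -> F -> 0 being a flabby      *)
(* resolution. Since F is stably a direct summand of a permutation lattice,   *)
(* Hilbert 90 extends the tautological map M -> k(A + M)^* equivariantly to   *)
(* P -> k(A + M)^*. As k(A + P)^G = k(A)^G(t) is purely transcendental (no-   *)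
(* name lemma), k(A + M)^G has a residue section over k(A)^G, hence over k.   *)
(* Next, embed A in a permutation lattice P': then k(A + M)^G lies    *)
(* in k(P' + M)^G = k(M)^G(t), and specializing t to a general point of k^p   *)
(* gives a residue section of k(M)^G. So retract rationality for a single     *)
(* faithful lattice gives it for all M as above, in particular for all        *)
(* faithful permutation lattices, among which the regular one yields k(G).    *)

Require Import Defs.
From HB Require Import structures.
From mathcomp Require Import all_boot all_order all_algebra all_fingroup.
From mathcomp Require Import all_character boolp.
From mathcomp.multinomials Require Import mpoly.

Set Implicit Arguments.
Unset Strict Implicit.
Unset Printing Implicit Defensive.

Import Order.TTheory GRing.Theory Num.Theory.
Local Open Scope ring_scope.

(** The six statements form a cycle in which each nontrivial step is an instance of one transfer
    principle, [retract_rational_lattice_transfer]: retract rationality passes from one faithful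
    lattice A to each faithful M with invertible flabby class. Permutation lattices M have such a
    class, by the resolution 0 -> M -> M -> 0 -> 0, and k(G) is the field of the regular lattice.

    Retract rationality is restated without an affine domain ([retract_rational_section],
    [section_retract_rational]): there are an L-valued point a of affine space and a k-embedding
    sigma of L in k(x) such that each sigma(z) is regular at a with value z. In this form it goes up
    a tower ([residue_section_trans]) and, k being infinite, down from a field between L and L(t) to
    L ([residue_section_specialize]).

    The transfer passes through A + M. For the way up from k(A)^G ([residue_section_dsum]), the
    injection M -> P embeds k(A + M) in k(A + P), and an equivariant extension P -> k(A + M)^* of
    the inclusion of M tells at which point the variables of P are to be evaluated to recover k(A +
    M). For the way down to k(M)^G ([residue_section_of_dsum]), A is embedded in a permutation
    lattice P', so that k(A + M)^G lies in k(M + P')^G, which is purely transcendental over k(M)^G.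
    In both moves Speiser's theorem ([twisted_fixed_basis]) supplies invariant coordinates t on the
    permutation module, and [specializes_descent] brings the coefficients of fractions in t into the
    fixed field. *)

Lemma rmorphism_of (R S : nzRingType) (f : R -> S) :
  zmod_morphism f -> monoid_morphism f -> exists g : {rmorphism R -> S}, g =1 f.
Proof.
move=> fB fM; pose B := GRing.isZmodMorphism.Build R S f fB.
pose M := GRing.isMonoidMorphism.Build R S f fM.
by exists (HB.pack f B M : {rmorphism R -> S}).
Qed.

(** * Evaluation of polynomials and of fractions *)

Section Mmap.

Variables (n : nat) (R S T : nzRingType).

Lemma rmorph_mmap (phi : {rmorphism S -> T}) (f : R -> S) (h : 'I_n -> S) p :
  phi (mmap f h p) = mmap (phi \o f) (phi \o h) p.
Proof.
rewrite rmorph_sum; apply: eq_bigr => m _; rewrite rmorphM rmorph_prod.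
by congr (_ * _); apply: eq_bigr => i _; rewrite rmorphXn.
Qed.

Lemma eq_mmap (f1 f2 : R -> S) (h1 h2 : 'I_n -> S) :
  f1 =1 f2 -> h1 =1 h2 -> mmap f1 h1 =1 mmap f2 h2.
Proof.
move=> ef eh p; apply: eq_bigr => m _; rewrite ef; congr (_ * _).
exact: mmap1_eq.
Qed.

End Mmap.

Lemma mmap_mpolyX n (R : nzRingType) (S : comNzRingType) (f : {rmorphism R -> S})
    (h : 'I_n -> S) i : mmap f h 'X_i = h i.
Proof. by rewrite mmapX mmap1U. Qed.

(* [mmapC] for a structure of ring morphism, which unification finds on       *)
(* compositions.                                                              *)
Lemma mmap_mpolyC n (R : nzRingType) (S : comNzRingType) (f : {rmorphism R -> S})
    (h : 'I_n -> S) c : mmap f h c%:MP = f c.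
Proof. exact: mmapC. Qed.

Lemma mpoly_morph_mmap n (R : nzRingType) (S : comNzRingType)
    (phi : {rmorphism {mpoly R[n]} -> S}) p :
  phi p = mmap (phi \o @mpolyC n R) (fun i => phi 'X_i) p.
Proof.
rewrite {1}(mpolyE p) rmorph_sum; apply: eq_bigr => m _.
rewrite -mul_mpolyC rmorphM mpolyXE_id rmorph_prod; congr (_ * _).
by apply: eq_bigr => i _; rewrite rmorphXn.
Qed.

Lemma mmap_map_mpoly n (R R' : nzRingType) (S : comNzRingType)
    (g : {rmorphism R -> R'}) (f : {rmorphism R' -> S}) (h : 'I_n -> S) p :
  mmap f h (map_mpoly g p) = mmap (f \o g) h p.
Proof.
rewrite /map_mpoly rmorph_mmap; apply: eq_mmap => x /=; first by rewrite mmapC.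
by rewrite mmap_mpolyX.
Qed.

(* B is an integral domain in all uses: [e] embeds it in a field, [h] is a    *)
(* specialization, and the fractions of F have h-regular representatives.     *)
Lemma partial_frac_hom (B F : comNzRingType) (E R : fieldType)
    (e : {rmorphism B -> E}) (h : {rmorphism B -> R}) (s : {rmorphism F -> E}) :
  injective e ->
  (forall z, exists p q, h q != 0 /\ s z * e q = e p) ->
  exists psi : {rmorphism F -> R}, forall z p q,
    h q != 0 -> s z * e q = e p -> psi z = h p / h q.
Proof.
move=> e_inj /choice[P /choice[Q PQ]].
pose f z := h (P z) / h (Q z).
have fE z p q : h q != 0 -> s z * e q = e p -> f z = h p / h q.
  move=> q0 zq; have [Q0 zQ] := PQ z.
  apply/eqP; rewrite eqr_div // -!rmorphM; apply/eqP; congr (h _).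
  by apply: e_inj; rewrite !rmorphM -zq -zQ mulrAC.
have fB : zmod_morphism f.
  move=> y z; have [Qy yQ] := PQ y; have [Qz zQ] := PQ z.
  rewrite (fE (y - z) (P y * Q z - P z * Q y) (Q y * Q z)).
  - by rewrite /f -[X in _ = _ + X]mulNr addf_div // rmorphB !rmorphM mulNr.
  - by rewrite rmorphM mulf_neq0.
  rewrite !rmorphB !rmorphM -yQ -zQ mulrBl mulrA; congr (_ - _).
  by rewrite -[RHS]mulrA (mulrC (e (Q y))).
have fM : monoid_morphism f.
  split=> [|y z].
    by rewrite (fE 1 1 1) ?(rmorph1 h) ?divr1 ?oner_neq0 // !rmorph1 mulr1.
  have [Qy yQ] := PQ y; have [Qz zQ] := PQ z.
  rewrite (fE (y * z) (P y * P z) (Q y * Q z)).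
  - by rewrite /f mulf_div !rmorphM.
  - by rewrite rmorphM mulf_neq0.
  by rewrite !rmorphM -yQ -zQ mulrACA.
have [psi psiE] := rmorphism_of fB fM.
by exists psi => z p q q0 zq; rewrite psiE; apply: fE.
Qed.

(* [specializes i i' t tau e w]: with t generic over K, the element e of      *)
(* K(t) is regular at t = tau, where it takes the value w. For fixed t and    *)
(* tau this is the graph of the residue map of a local ring.                  *)
Definition specializes (K : comNzRingType) (F E : fieldType) n
    (i : K -> F) (i' : K -> E) (t : 'I_n -> E) (tau : 'I_n -> F)
    (e : E) (w : F) : Prop :=
  exists p q : {mpoly K[n]},
    [/\ mmap i tau q != 0, e * mmap i' t q = mmap i' t p
      & w * mmap i tau q = mmap i tau p].

(** Algebraic independence of t; constant p make it include the injectivity of i'. *)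
Definition generic_over (K : comNzRingType) (E : fieldType) n
    (i' : K -> E) (t : 'I_n -> E) : Prop :=
  forall p : {mpoly K[n]}, mmap i' t p = 0 -> p = 0.

Lemma generic_inj (K : comNzRingType) (E : fieldType) n
    (i' : {rmorphism K -> E}) (t : 'I_n -> E) :
  generic_over i' t -> injective (mmap i' t).
Proof.
move=> gen p q epq; apply/eqP; rewrite -subr_eq0; apply/eqP/gen.
by rewrite rmorphB /= epq subrr.
Qed.

(** * Calculus of the specialization relation *)

Section Specializes.

Variables (K : comNzRingType) (F E : fieldType) (n : nat).
Variables (i : {rmorphism K -> F}) (i' : {rmorphism K -> E}).
Variables (t : 'I_n -> E) (tau : 'I_n -> F).

Local Notation spec := (specializes i i' t tau).

Lemma spec_const c : spec (i' c) (i c).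
Proof. by exists c%:MP, 1; rewrite !rmorph1 !mmapC !mulr1 oner_neq0. Qed.

Lemma spec_var j : spec (t j) (tau j).
Proof. by exists 'X_j, 1; rewrite !mmap_mpolyX !rmorph1 !mulr1 oner_neq0. Qed.

Lemma spec0 : spec 0 0.
Proof. by have := spec_const 0; rewrite !rmorph0. Qed.

Lemma spec1 : spec 1 1.
Proof. by have := spec_const 1; rewrite !rmorph1. Qed.

Lemma specM e w e' w' : spec e w -> spec e' w' -> spec (e * e') (w * w').
Proof.
move=> [p [q [q0 eq wq]]] [p' [q' [q0' eq' wq']]]; exists (p * p'), (q * q').
by rewrite !rmorphM /= mulf_neq0 // -eq -eq' -wq -wq'; split=> //; rewrite mulrACA.
Qed.

Lemma specD e w e' w' : spec e w -> spec e' w' -> spec (e + e') (w + w').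
Proof.
move=> [p [q [q0 eq wq]]] [p' [q' [q0' eq' wq']]].
exists (p * q' + p' * q), (q * q').
rewrite !rmorphD !rmorphM /= mulf_neq0 // -eq -eq' -wq -wq'.
by split=> //; rewrite mulrDl !mulrA; congr (_ + _); rewrite mulrAC.
Qed.

Lemma spec_sum (I : Type) (r : seq I) (e : I -> E) (w : I -> F) :
  (forall l, spec (e l) (w l)) ->
  spec (\sum_(l <- r) e l) (\sum_(l <- r) w l).
Proof. by move=> ew; elim/big_rec2: _ => [|l *]; [exact: spec0|apply: specD]. Qed.

Lemma spec_prod (I : Type) (r : seq I) (e : I -> E) (w : I -> F) :
  (forall l, spec (e l) (w l)) ->
  spec (\prod_(l <- r) e l) (\prod_(l <- r) w l).
Proof. by move=> ew; elim/big_rec2: _ => [|l *]; [exact: spec1|apply: specM]. Qed.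

Lemma specX e w m : spec e w -> spec (e ^+ m) (w ^+ m).
Proof.
by move=> ew; elim: m => [|m IHm]; [exact: spec1 | rewrite !exprS; apply: specM].
Qed.

Lemma spec_mmap (K' : comNzRingType) m (f : K' -> E) (g : K' -> F)
    (x : 'I_m -> E) (y : 'I_m -> F) :
  (forall c, spec (f c) (g c)) -> (forall j, spec (x j) (y j)) ->
  forall p, spec (mmap f x p) (mmap g y p).
Proof.
move=> fg xy p; apply: spec_sum => l; apply: specM => //.
by apply: spec_prod => j; apply: specX.
Qed.

(** The condition e != 0 replaces genericity of t, for coefficient rings that need not embed in
    E. *)
Lemma specV_neq0 e w : e != 0 -> w != 0 -> spec e w -> spec e^-1 w^-1.
Proof.
move=> e0 w0 [p [q [q0 eq wq]]].
by exists q, p; rewrite -wq -eq !mulKf // mulf_neq0.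
Qed.

Hypothesis t_gen : generic_over i' t.

Lemma spec_uniq e w w' : spec e w -> spec e w' -> w = w'.
Proof.
move=> [p [q [q0 eq wq]]] [p' [q' [q0' eq' wq']]].
have pq : p * q' = p' * q.
  by apply: (generic_inj t_gen); rewrite !rmorphM /= -eq -eq' mulrAC.
apply: (mulIf (mulf_neq0 q0 q0')).
by rewrite mulrA wq (mulrC (mmap i tau q)) mulrA wq' -!rmorphM /= pq.
Qed.

Lemma spec_neq0 e w : w != 0 -> spec e w -> e != 0.
Proof.
move=> w0 ew; apply: contra_neq w0 => e0; move: ew; rewrite e0 => /spec_uniq.
by apply; apply: spec0.
Qed.

Lemma specV e w : w != 0 -> spec e w -> spec e^-1 w^-1.
Proof.
by move=> w0 ew; apply: specV_neq0 => //; exact: spec_neq0 ew.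
Qed.

Lemma specXz e w (m : int) : w != 0 -> spec e w -> spec (e ^ m) (w ^ m).
Proof.
move=> w0 ew; case: m => m; first exact: specX.
by rewrite !NegzE -!exprnN; apply: specV; [rewrite expf_neq0 | apply: specX].
Qed.

End Specializes.

Lemma spec_ratfun (K : comNzRingType) (F E : fieldType) n
    (i : {rmorphism K -> F}) (i' : {rmorphism K -> E})
    (t : 'I_n -> E) (tau : 'I_n -> F) (k : fieldType) m
    (f : {rmorphism ratfun k m -> E}) (g : {rmorphism ratfun k m -> F}) :
  generic_over i' t ->
  (forall c, specializes i i' t tau (f (rfC m c)) (g (rfC m c))) ->
  (forall j, specializes i i' t tau (f (rfX k j)) (g (rfX k j))) ->
  forall z, specializes i i' t tau (f z) (g z).
Proof.
move=> t_gen fgC fgX z; rewrite (ratfunE z).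
move: (denom_ratioP (generic_quotient.repr z)).
move: (\n__) (\d__) => a b b0; have fgP p : specializes i i' t tau (f (rfP p)) (g (rfP p)).
  have := spec_mmap fgC fgX p.
  rewrite -(mpoly_morph_mmap (f \o @rfP k m)).
  by rewrite -(mpoly_morph_mmap (g \o @rfP k m)).
rewrite !fmorph_div; apply: specM => //; apply: specV => //.
by rewrite fmorph_eq0 rfP_eq0.
Qed.

Lemma mmap_rfX (k : fieldType) n (p : {mpoly k[n]}) :
  mmap (@rfC k n) (@rfX k n) p = rfP p.
Proof. by rewrite (mpoly_morph_mmap (@rfP k n)). Qed.

Lemma rfP_inj (k : fieldType) n : injective (@rfP k n).
Proof.
move=> p q pq; apply/eqP.
by rewrite -subr_eq0 -rfP_eq0 rmorphB /= pq subrr.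
Qed.

Lemma rfX_generic (k : fieldType) n : generic_over (@rfC k n) (@rfX k n).
Proof. by move=> p; rewrite mmap_rfX => /eqP; rewrite rfP_eq0 => /eqP. Qed.

(* The field L is the residue field, at the point a, of a local ring of       *)
(* affine space that contains a copy sigma(L) of L.                           *)
Definition residue_section (k L : fieldType) (iL : k -> L) : Prop :=
  exists m (a : 'I_m -> L) (sigma : {rmorphism L -> ratfun k m}),
    (forall c, sigma (iL c) = rfC m c) /\
    forall z, specializes iL (@rfC k m) (@rfX k m) a (sigma z) z.

(** * Retract rationality as existence of a residue section *)

Section MpolyLocalization.

Variables (k : fieldType) (n : nat) (f : {mpoly k[n]}).

Lemma rfP_mploc p : rfP p \in mploc_pred f.
Proof. by apply/asboolP; exists p, 0; rewrite expr0 divr1. Qed.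

Definition mplocP p : mploc f := MpLoc (rfP_mploc p).

Lemma mplocP_is_zmod_morphism : zmod_morphism mplocP.
Proof. by move=> p q; apply: val_inj; rewrite /= rmorphB. Qed.
Lemma mplocP_is_monoid_morphism : monoid_morphism mplocP.
Proof.
by split=> [|p q]; apply: val_inj; [rewrite /= rmorph1 | rewrite /= rmorphM].
Qed.
HB.instance Definition _ :=
  GRing.isZmodMorphism.Build _ _ mplocP mplocP_is_zmod_morphism.
HB.instance Definition _ :=
  GRing.isMonoidMorphism.Build _ _ mplocP mplocP_is_monoid_morphism.

Lemma mplocP_unit : f != 0 -> exists u, mplocP f * u = 1.
Proof.
move=> f0; have fV : (rfP f)^-1 \in mploc_pred f.
  by apply/asboolP; exists 1, 1; rewrite rmorph1 expr1 div1r.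
by exists (MpLoc fV); apply: val_inj; rewrite /= mulfV // rfP_eq0.
Qed.

Lemma mploc_frac (u : mploc f) : exists p m, val u = rfP p / rfP f ^+ m.
Proof. by case: u => u /= /asboolP. Qed.

End MpolyLocalization.

(** The kernel of psi is a point of affine space where f does not vanish, with coordinates psi(X_i).
    Extended to fractions, phi is the copy of L in k(x), and psi o phi = 1 says that the value of
    phi(x) at this point is x. *)
Lemma retract_rational_section (k L : fieldType) (iL : {rmorphism k -> L}) :
  retract_rational iL -> residue_section iL.
Proof.
move=> [A [iA [j [_ [j_inj jC] frac [n [f [phi [psi [f0 phiC psiC phiK]]]]]]]]].
pose h : {rmorphism A -> ratfun k n} := val \o phi.
have h_inj : injective h by move=> x y /val_inj/(can_inj phiK).
have hV x : x != 0 -> h x != 0.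
  by apply: contra_neq => hx; apply: h_inj; rewrite hx rmorph0.
have jV x : x != 0 -> j x != 0.
  by apply: contra_neq => jx; apply: j_inj; rewrite jx rmorph0.
pose a i : L := j (psi (mplocP f 'X_i)).
have psiP p : j (psi (mplocP f p)) = mmap iL a p.
  apply: etrans (mpoly_morph_mmap (j \o psi \o mplocP f) p) _.
  apply: eq_mmap => c //=; rewrite -jC -psiC; congr (j (psi _)).
  exact: val_inj.
have [fV fVK] := mplocP_unit f0.
have fa0 : mmap iL a f != 0.
  rewrite -psiP; apply: contra_eq_neq (congr1 (j \o psi) fVK) => /= fa.
  by rewrite !rmorphM fa mul0r !rmorph1 eq_sym oner_neq0.
have spec_h x : specializes iL (@rfC k n) (@rfX k n) a (h x) (j x).
  have [p [m hx]] := mploc_frac (phi x); exists p, (f ^+ m).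
  have f0' : rfP f ^+ m != 0 by rewrite expf_neq0 ?rfP_eq0.
  rewrite !mmap_rfX !rmorphXn expf_neq0 // /h /= hx divfK //; split=> //.
  rewrite -!psiP -[x in j x]phiK -(rmorphXn j) -(rmorphXn psi).
  rewrite -(rmorphM j) -(rmorphM psi); congr (j (psi _)).
  by apply: val_inj; rewrite rmorphM rmorphXn /= hx divfK.
have [|sigma sigmaE] := @partial_frac_hom A L L _ j h idfun j_inj.
  move=> z; have [x [y [y0 ->]]] := frac z; exists x, y.
  by rewrite hV // divfK ?jV.
have sigma_j x : sigma (j x) = h x.
  by rewrite (sigmaE _ x 1) ?rmorph1 ?mulr1 ?divr1 ?oner_neq0.
exists n, a, sigma; split=> [c|z].
  by rewrite -jC sigma_j /h /= phiC.
have [x [y [y0 ->]]] := frac z; rewrite fmorph_div !sigma_j.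
apply: specM; first exact: spec_h.
by apply: specV; [exact: rfX_generic | exact: jV | exact: spec_h].
Qed.

Section ImageRing.

Variables (S : comNzRingType) (L : fieldType) (ev : {rmorphism S -> L}).

Definition image_pred : {pred L} := fun z => `[< exists x, z = ev x >].

Lemma image_subring_closed : subring_closed image_pred.
Proof.
split=> [|y z /asboolP[u ->] /asboolP[v ->]|y z /asboolP[u ->] /asboolP[v ->]];
  apply/asboolP; first by exists 1; rewrite rmorph1.
  by exists (u - v); rewrite rmorphB.
by exists (u * v); rewrite rmorphM.
Qed.

HB.instance Definition _ :=
  GRing.isSubringClosed.Build _ image_pred image_subring_closed.

Record image_ring := ImageRing { image_val :> L; _ : image_val \in image_pred }.

HB.instance Definition _ := [isSub for image_val].
HB.instance Definition _ := [Choice of image_ring by <:].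
HB.instance Definition _ := [SubChoice_isSubComNzRing of image_ring by <:].

Definition image_unit : pred image_ring :=
  fun x => (val x != 0) && ((val x)^-1 \in image_pred).
Definition image_inv (x : image_ring) : image_ring :=
  if image_unit x then insubd x (val x)^-1 else x.

Lemma image_mulVr : {in image_unit, left_inverse 1 image_inv *%R}.
Proof.
move=> x /[dup] xU /andP[x0 xV]; apply: val_inj.
by rewrite /image_inv (_ : image_unit x) //= insubdK // mulVf.
Qed.

Lemma image_unitP x y : y * x = 1 -> image_unit x.
Proof.
move=> /(congr1 val) /= yx; have x0 : val x != 0.
  by apply: contra_eq_neq yx => ->; rewrite mulr0 eq_sym oner_neq0.
by rewrite /image_unit x0 -[_^-1]mul1r -yx mulfK //; case: (y).
Qed.

Lemma image_inv_out : {in [predC image_unit], image_inv =1 id}.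
Proof. by move=> x; rewrite /image_inv; case: ifP => // xU /negP[]; exact: xU. Qed.

HB.instance Definition _ := GRing.ComNzRing_hasMulInverse.Build image_ring
  image_mulVr image_unitP image_inv_out.

Lemma image_mulf_eq0 (x y : image_ring) :
  x * y = 0 -> (x == 0) || (y == 0).
Proof.
move=> /(congr1 val) /= /eqP; rewrite mulf_eq0.
by case/orP => /eqP xy; apply/orP; [left | right]; apply/eqP/val_inj.
Qed.

HB.instance Definition _ :=
  GRing.ComUnitRing_isIntegral.Build image_ring image_mulf_eq0.

Lemma image_ring_factor (R : comNzRingType) (f : {rmorphism R -> L}) :
  (forall c, exists x, f c = ev x) ->
  exists f' : {rmorphism R -> image_ring}, forall c, val (f' c) = f c.
Proof.
move=> fev; have fA c : f c \in image_pred by apply/asboolP.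
have [||f' f'E] := @rmorphism_of R image_ring (fun c => ImageRing (fA c)).
- by move=> c d; apply: val_inj; rewrite /= rmorphB.
- by split=> [|c d]; apply: val_inj; rewrite /= ?rmorph1 ?rmorphM.
by exists f' => c; rewrite f'E.
Qed.

End ImageRing.

Lemma rpred_mmap n (R : nzRingType) (S : nzRingType) (A : subringClosed S)
    (f : R -> S) (h : 'I_n -> S) p :
  (forall c, f c \in A) -> (forall i, h i \in A) -> mmap f h p \in A.
Proof.
move=> fA hA; rewrite rpred_sum // => m _; rewrite rpredM // rpred_prod // => i _.
by rewrite rpredX.
Qed.

Lemma common_denominator (k L : fieldType) m (iL : {rmorphism k -> L})
    (a : 'I_m -> L) n (s : 'I_n -> ratfun k m) (w : 'I_n -> L) :
  (forall i, specializes iL (@rfC k m) (@rfX k m) a (s i) (w i)) ->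
  exists Q (P : 'I_n -> {mpoly k[m]}),
    mmap iL a Q != 0 /\ forall i, s i * rfP Q = rfP (P i).
Proof.
move=> /choice[p /choice[q pq]]; exists (\prod_i q i).
exists (fun i => p i * \prod_(j | j != i) q j); split=> [|i].
  by rewrite rmorph_prod prodf_seq_neq0; apply/allP => i _ /=; case: (pq i).
rewrite (bigD1 i) //= !rmorphM /= mulrA -!mmap_rfX; congr (_ * _).
by case: (pq i).
Qed.

(** A is the image of the evaluation at a on k[x][1/f]; psi is this evaluation and phi is the
    restriction of sigma. The point is to choose f so that sigma maps A into k[x][1/f]. *)
Lemma section_retract_rational (k L : fieldType) (iL : {rmorphism k -> L}) :
  residue_section iL -> retract_rational iL.
Proof.
move=> [n [a [sigma [sigmaC spec_s]]]].
have gen := @rfX_generic k n.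
have [Q [P [Qa0 PQ]]] := common_denominator (fun i => spec_s (a i)).
have Q0 : rfP Q != 0.
  by rewrite rfP_eq0; apply: contra_neq Qa0 => ->; rewrite rmorph0.
have sigma_mmap p : sigma (mmap iL a p) = mmap (@rfC k n) (sigma \o a) p.
  by rewrite rmorph_mmap; apply: eq_mmap.
have aQ i : sigma (a i) = rfP (P i) / rfP Q by rewrite -PQ mulfK.
(* Q' has to be inverted too: A will contain 1/Q(a), and sigma sends it to Q^N / Q'. *)
have [Q' [N sQ]] : exists Q' N, sigma (mmap iL a Q) = rfP Q' / rfP Q ^+ N.
  apply/asboolP; rewrite sigma_mmap.
  apply: (@rpred_mmap _ _ _ (mploc_pred Q)) => [c|i]; first exact: rfC_mploc.
  by rewrite /= aQ; apply/asboolP; exists (P i), 1%N.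
(* The value of sigma(Q(a)) at a is Q(a), so Q'(a) = Q(a)^(N+1), and inverting f(a) amounts to
   inverting Q(a). *)
have evQ' : mmap iL a Q' = mmap iL a Q * mmap iL a Q ^+ N.
  have spQ p : specializes iL (@rfC k n) (@rfX k n) a (rfP p) (mmap iL a p).
    rewrite -mmap_rfX; apply: spec_mmap => [c|i]; first exact: spec_const.
    exact: spec_var.
  have := spec_s (mmap iL a Q); rewrite sQ => /(spec_uniq gen) e.
  have {1}<- : mmap iL a Q' / mmap iL a Q ^+ N = mmap iL a Q.
    apply/esym/e; apply: specM => //.
    by apply: specV => //; [rewrite expf_neq0 | apply: specX].
  by rewrite divfK // expf_neq0.
have [f fE] : exists f, f = Q * Q' by exists (Q * Q').
have Q'a0 : mmap iL a Q' != 0 by rewrite evQ' mulf_neq0 // expf_neq0.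
have fa0 : mmap iL a f != 0 by rewrite fE rmorphM mulf_neq0.
have fXa0 m : mmap iL a (f ^+ m) != 0 by rewrite rmorphXn expf_neq0.
have f0 : f != 0 by apply: contra_neq fa0 => ->; rewrite rmorph0.
have Q'0 : Q' != 0 by apply: contra_neq Q'a0 => ->; rewrite rmorph0.
have Q'0' : rfP Q' != 0 by rewrite rfP_eq0.
have f0' : rfP f != 0 by rewrite rfP_eq0.
have fX0 m : rfP f ^+ m != 0 by exact: expf_neq0.
have [|ev evE] := @partial_frac_hom _ (mploc f) _ _ _ (mmap iL a) val (@rfP_inj k n).
  move=> z; have [p [m zE]] := mploc_frac z; exists p, (f ^+ m).
  split; first exact: fXa0.
  transitivity (rfP p / rfP f ^+ m * rfP (f ^+ m)); first by congr (_ * _).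
  by rewrite rmorphXn (divfK (fX0 m)).
have spec_ev x : specializes iL (@rfC k n) (@rfX k n) a (val x) (ev x).
  have [p [m xE]] := mploc_frac x; exists p, (f ^+ m); split=> //.
    by rewrite !mmap_rfX rmorphXn xE (divfK (fX0 m)).
  rewrite (evE x p (f ^+ m)) ?divfK ?fXa0 //.
  transitivity (rfP p / rfP f ^+ m * rfP (f ^+ m)); first by congr (_ * _).
  by rewrite rmorphXn (divfK (fX0 m)).
have evP p : ev (mplocP f p) = mmap iL a p.
  by rewrite (evE _ p 1) ?rmorph1 ?mulr1 ?divr1 // oner_neq0.
have evC c : ev (mplocC f c) = iL c.
  have -> : mplocC f c = mplocP f c%:MP by exact: val_inj.
  by rewrite evP mmapC.
pose A := image_ring ev.
have [psi psiE] : exists psi : {rmorphism mploc f -> A}, forall x, val (psi x) = ev x.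
  by apply: image_ring_factor => x; exists x.
have [iA iAE] : exists iA : {rmorphism k -> A}, forall c, val (iA c) = iL c.
  by apply: image_ring_factor => c; exists (mplocC f c).
have psiC c : psi (mplocC f c) = iA c by apply: val_inj; rewrite psiE evC iAE.
have sA (x : A) : sigma (val x) \in mploc_pred f.
  case: x => x /= /asboolP[u ->]; have [p [m uE]] := mploc_frac u.
  rewrite (evE u p (f ^+ m)) ?fXa0 //; last first.
    transitivity (rfP p / rfP f ^+ m * rfP (f ^+ m)); first by congr (_ * _).
    by rewrite rmorphXn (divfK (fX0 m)).
  rewrite fmorph_div rpredM //.
    rewrite sigma_mmap; apply: rpred_mmap => [c|i]; first exact: rfC_mploc.
    rewrite /= aQ; apply/asboolP; exists (P i * Q'), 1%N.
    by rewrite expr1 fE !rmorphM invfM mulrACA (divff Q'0') mulr1.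
  have sQV : (sigma (mmap iL a Q))^-1 \in mploc_pred f.
    rewrite sQ invf_div; apply/asboolP; exists (Q ^+ N * Q), 1%N.
    by rewrite expr1 fE !rmorphM /= rmorphXn -[_ * rfP Q]mulrC invfM mulrACA (divff Q0) mul1r.
  rewrite rmorphXn /= rmorphXn -exprVn rpredX //.
  have -> : mmap iL a f = mmap iL a Q * (mmap iL a Q * mmap iL a Q ^+ N).
    by rewrite fE rmorphM /= evQ'.
  rewrite !rmorphM /=.
  rewrite !invfM rmorphXn /= -exprVn.
  by apply: rpredM => //; apply: rpredM => //; apply: rpredX.
have [||phi phiE] := @rmorphism_of A (mploc f) (fun x => MpLoc (sA x)).
- by move=> x y; apply: val_inj; rewrite /= rmorphB.
- by split=> [|x y]; apply: val_inj; rewrite /= ?rmorph1 ?rmorphM.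
have [fV fVK] := mplocP_unit f0.
exists A, iA, val; split=> //.
(* Generators of A: the images of the n variables and, at the last index, of 1/f. *)
- pose b (i : 'I_n.+1) : A :=
    if unlift ord_max i is Some l then psi (mplocP f 'X_l) else psi fV.
  exists n.+1, b => x.
  have [u xu] : exists u, x = psi u.
    case: x => x xA; have /asboolP[u xu] := xA.
    by exists u; apply: val_inj; rewrite psiE.
  have [p [m uE]] := mploc_frac u.
  exists (mmap (@mpolyC n.+1 k) (fun i => 'X_(lift ord_max i)) p * 'X_ord_max ^+ m).
  rewrite xu rmorphM rmorphXn /= mmap_mpolyX {2}/b unlift_none rmorph_mmap.
  have -> : u = mplocP f p * fV ^+ m.
    apply: val_inj; rewrite uE rmorphM rmorphXn /= -exprVn; congr (_ * _ ^+ _).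
    have fVK' : rfP f * val fV = 1 := congr1 val fVK.
    by apply: (mulfI f0'); rewrite fVK' divff.
  rewrite rmorphM rmorphXn /=; congr (_ * _).
  apply: etrans (mpoly_morph_mmap (psi \o mplocP f) p) _.
  apply: eq_mmap => [c|l] /=; last by rewrite mmap_mpolyX /b liftK.
  by rewrite mmap_mpolyC -psiC; congr (psi _); exact: val_inj.
- by split=> //; exact: val_inj.
- move=> z; have [p [q [q0 _ zq]]] := spec_s z.
  exists (psi (mplocP f p)), (psi (mplocP f q)).
  rewrite /= !psiE !evP -zq mulfK //; split=> //.
  by apply: contra_neq q0 => /(congr1 val); rewrite psiE evP.
exists n, f, phi, psi; split=> //.
- move=> c; rewrite phiE; apply: val_inj => /=; by rewrite iAE sigmaC.
move=> x; apply: val_inj; rewrite psiE.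
apply: (spec_uniq gen (spec_ev _)); rewrite phiE; exact: spec_s.
Qed.

Lemma mmap_mmap n m (R R' : nzRingType) (S : comNzRingType)
    (g : {rmorphism R -> R'}) (f : {rmorphism R' -> S})
    (h : 'I_m -> S) (x : 'I_n -> {mpoly R'[m]}) p :
  mmap f h (mmap (@mpolyC m R' \o g) x p) = mmap (f \o g) (mmap f h \o x) p.
Proof. by rewrite rmorph_mmap; apply: eq_mmap => c //=; rewrite mmapC. Qed.

Lemma ratfun_hom (k E : fieldType) n (iE : {rmorphism k -> E}) (h : 'I_n -> E) :
  generic_over iE h ->
  exists phi : {rmorphism ratfun k n -> E},
    (forall c, phi (rfC n c) = iE c) /\ (forall i, phi (rfX k i) = h i).
Proof.
move=> h_gen; have h_inj := generic_inj h_gen.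
have [|phi phiE] :=
    @partial_frac_hom _ (ratfun k n) _ _ _ (mmap iE h) idfun (@rfP_inj k n).
  move=> z; exists \n_(generic_quotient.repr z), \d_(generic_quotient.repr z).
  have d0 := denom_ratioP (generic_quotient.repr z); split.
    by rewrite raddf_eq0.
  by rewrite {1}(ratfunE z) divfK // rfP_eq0.
have phiP p : phi (rfP p) = mmap iE h p.
  by rewrite (phiE _ p 1) ?rmorph1 ?divr1 ?oner_neq0 //= mulr1.
exists phi; split=> [c|i]; first by rewrite phiP mmapC.
by rewrite phiP mmap_mpolyX.
Qed.

Lemma generic_sub (K : comNzRingType) (E : fieldType) (iE : {rmorphism K -> E})
    n m (h : 'I_m -> E) (f : 'I_n -> 'I_m) :
  injective f -> generic_over iE h -> generic_over iE (h \o f).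
Proof.
move=> f_inj h_gen p p0.
pose q : {mpoly K[m]} := mmap (@mpolyC m K) (fun i => 'X_(f i)) p.
have q0 : q = 0.
  apply: h_gen; rewrite -[RHS]p0 rmorph_mmap.
  by apply: eq_mmap => x; rewrite /= ?mmap_mpolyC ?mmap_mpolyX.
pose r (i : 'I_m) : {mpoly K[n]} :=
  if [pick j | f j == i] is Some j then 'X_j else 0.
have : mmap (@mpolyC n K) r q = p.
  rewrite /q rmorph_mmap [RHS](mpoly_morph_mmap idfun).
  apply: eq_mmap => x /=; first by rewrite mmap_mpolyC.
  rewrite mmap_mpolyX /r; case: pickP => [j /eqP/f_inj -> //|/(_ x)].
  by rewrite eqxx.
by rewrite q0 rmorph0.
Qed.

(** * Composition of residue sections over an intermediate field *)

Section Transitivity.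

Variables (k L L1 E : fieldType) (iL : {rmorphism k -> L}).
Variables (i1 : {rmorphism L -> L1}) (sigma : {rmorphism L1 -> E}).
Variables (n : nat) (t : 'I_n -> E) (tau : 'I_n -> L1).

(** The new point is (a, tau), in m + n coordinates. The new section writes sigma(z) as a fraction
    in L(t) and applies s to its coefficients; the denominator stays nonzero because its value at
    (a, tau) is its value at tau. *)
Lemma residue_section_trans :
  generic_over (sigma \o i1) t ->
  (forall z, specializes i1 (sigma \o i1) t tau (sigma z) z) ->
  residue_section iL -> residue_section (i1 \o iL).
Proof.
move=> t_gen spec_tau [m [a [s [sC spec_a]]]].
have [wid [widC widX]] :=
    ratfun_hom (generic_sub (@lshift_inj m n) (@rfX_generic k (m + n))).
pose a' i := match split i with inl j => i1 (a j) | inr j => tau j end.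
have a'l j : a' (lshift n j) = i1 (a j) by rewrite /a' (unsplitK (inl j)).
have a'r j : a' (rshift m j) = tau j by rewrite /a' (unsplitK (inr j)).
pose spec := specializes (i1 \o iL) (@rfC k (m + n)) (@rfX k (m + n)) a'.
have gen := @rfX_generic k (m + n).
have spec_l l : spec (wid (s l)) (i1 l).
  have [p [q [q0 eq wq]]] := spec_a l.
  have ev r : mmap (i1 \o iL) a' (mmap (@mpolyC (m + n) k) (fun j => 'X_(lshift n j)) r)
            = i1 (mmap iL a r).
    rewrite (mmap_mmap idfun) rmorph_mmap.
    by apply: eq_mmap => j //=; rewrite mmap_mpolyX a'l.
  have ev' r : mmap (@rfC k (m + n)) (@rfX k (m + n))
                 (mmap (@mpolyC (m + n) k) (fun j => 'X_(lshift n j)) r)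
            = wid (mmap (@rfC k m) (@rfX k m) r).
    rewrite (mmap_mmap idfun) rmorph_mmap.
    by apply: eq_mmap => j /=; rewrite ?widC ?widX ?mmap_mpolyX.
  exists (mmap (@mpolyC (m + n) k) (fun j => 'X_(lshift n j)) p).
  exists (mmap (@mpolyC (m + n) k) (fun j => 'X_(lshift n j)) q).
  by rewrite !ev !ev' -eq -wq !rmorphM fmorph_eq0.
pose h : {mpoly L[n]} -> ratfun k (m + n) :=
  mmap (wid \o s) (fun j => rfX k (rshift m j)).
have spec_h r : spec (h r) (mmap i1 tau r).
  apply: spec_mmap => // j; rewrite -a'r; exact: spec_var.
have h0 q : mmap i1 tau q != 0 -> h q != 0.
  by move/spec_neq0; apply; [exact: gen | exact: spec_h].
have [|psi psiE] := @partial_frac_hom _ L1 _ _ _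
    (mmap (wid \o s) (fun j => rfX k (rshift m j))) sigma (generic_inj t_gen).
  by move=> z; have [p [q [q0 eq _]]] := spec_tau z; exists p, q; split=> //; apply: h0.
exists (m + n)%N, a', psi; split=> [c|z].
  rewrite /= (psiE _ (iL c)%:MP 1) ?rmorph1 ?oner_neq0 // ?divr1 ?mulr1.
    by rewrite /= mmap_mpolyC /= sC widC.
  by rewrite /= mmap_mpolyC.
have [p [q [q0 eq wq]]] := spec_tau z.
rewrite (psiE _ p q) //; last exact: h0.
rewrite -[X in specializes _ _ _ _ _ X](mulfK q0) wq.
apply: specM; first exact: spec_h.
by apply: specV => //; exact: spec_h.
Qed.

End Transitivity.

(** * Specialization of parameters in an infinite field *)

Lemma digits_inj B n (u v : 'I_n -> nat) :
  (forall i, u i < B)%N -> (forall i, v i < B)%N ->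
  (\sum_(i < n) u i * B ^ i = \sum_(i < n) v i * B ^ i)%N -> u =1 v.
Proof.
elim: n u v => [|n IHn] u v uB vB; first by move=> _ [].
have B0 : (0 < B)%N by apply: leq_ltn_trans (uB ord0).
have shift (w : 'I_n.+1 -> nat) : (\sum_(i < n.+1) w i * B ^ i =
    (\sum_(i < n) w (lift ord0 i) * B ^ i) * B + w ord0)%N.
  rewrite big_ord_recl muln1 addnC big_distrl /=; congr (_ + _)%N.
  by apply: eq_bigr => i _; rewrite -mulnA -expnSr.
rewrite !shift => e.
have e0 : u ord0 = v ord0.
  by have := congr1 (modn^~ B) e; rewrite /= !modnMDl !modn_small.
move: e; rewrite e0 => /addIn /eqP; rewrite eqn_pmul2r // => /eqP e.
have {}IHn := IHn (u \o lift ord0) (v \o lift ord0) (fun i => uB _) (fun i => vB _) e.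
move=> i; case: (unliftP ord0 i) => [j|] -> //; exact: IHn.
Qed.

Lemma poly_nonroot (k L : fieldType) (iL : {rmorphism k -> L}) (p : {poly L}) :
  infinite_field k -> p != 0 -> exists c, p.[iL c] != 0.
Proof.
move=> k_inf p0.
have [s s_root] : exists s : seq k, forall c, root p (iL c) -> c \in s.
  elim/ltn_ind: {p}(size p) {-2}p (erefl (size p)) p0 => d IHd p pd p0.
  have [[c pc]|noroot] := pselect (exists c, root p (iL c)); last first.
    by exists [::] => c pc; case: noroot; exists c.
  have /factor_theorem[q pq] := pc.
  have q0 : q != 0 by apply: contra_neq p0 => q0; rewrite pq q0 mul0r.
  have [|s sP] := IHd (size q) _ q erefl q0.
    by rewrite -pd pq size_Mmonic ?monicXsubC // size_XsubC addn2.
  exists (c :: s) => e; rewrite pq rootM root_XsubC inE (inj_eq (fmorph_inj iL)).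
  by case/orP => [/sP ->|->]; rewrite ?orbT.
have [c cs] := k_inf s; exists c; apply: contra cs => pc.
by apply: s_root; apply/eqP/eqP.
Qed.

(* Kronecker substitution.                                                    *)
Lemma mpoly_nonroot (k L : fieldType) (iL : {rmorphism k -> L}) n
    (p : {mpoly L[n]}) :
  infinite_field k -> p != 0 -> exists c : 'I_n -> k, mmap idfun (iL \o c) p != 0.
Proof.
move=> k_inf p0; pose B := msize p.
have supB m i : m \in msupp p -> (m i < B)%N.
  move=> /msize_mdeg_lt; apply: leq_ltn_trans; rewrite mdegE (bigD1 i) //=.
  exact: leq_addr.
pose w (m : 'X_{1..n}) := (\sum_(i < n) m i * B ^ i)%N.
pose r : {poly L} := \sum_(m <- msupp p) p@_m *: 'X^(w m).
(* The exponents in p are below B, so w is injective on the support of p and no terms of r merge. *)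
have r0 : r != 0.
  have m0 := mlead_supp p0; have c0 : p@_(mlead p) != 0 by rewrite mleadc_eq0.
  apply: contra_neq c0 => r0; move: (congr1 (coefp (w (mlead p))) r0).
  rewrite /= coef0 coef_sum (big_rem (mlead p)) //= coefZ coefXn eqxx mulr1.
  rewrite big_seq big1 ?addr0 // => m; rewrite mem_rem_uniq ?msupp_uniq // inE.
  case/andP=> mN mp; rewrite coefZ coefXn; case: eqP; last by rewrite mulr0.
  move=> /digits_inj e; case/eqP: mN; apply/mnmP => i; apply/esym/e => j; exact: supB.
have [c rc] := poly_nonroot iL k_inf r0.
exists (fun i => c ^+ (B ^ i)); apply: contra_neq rc => pc.
rewrite horner_sum -[RHS]pc; apply: eq_bigr => m _; rewrite hornerZ hornerXn.
congr (_ * _); rewrite -prodrXr; apply: eq_bigr => i _ /=.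
by rewrite rmorphXn /= -exprM mulnC.
Qed.

(* The coefficients of fractions in L(t) representing the b_j generate L:     *)
(* for z in L, clearing denominators in z = P(b) / Q(b) gives z v = u with    *)
(* u, v in L[t], and z is a quotient of two coefficients.                     *)
Lemma residue_subfield_finite (k L E : fieldType) (iL : {rmorphism k -> L})
    (i' : {rmorphism L -> E}) n (t : 'I_n -> E) m (b : 'I_m -> E) :
  generic_over i' t ->
  (forall j, exists p q : {mpoly L[n]}, q != 0 /\ b j * mmap i' t q = mmap i' t p) ->
  (forall z, exists P Q : {mpoly k[m]},
     mmap (i' \o iL) b Q != 0 /\ i' z * mmap (i' \o iL) b Q = mmap (i' \o iL) b P) ->
  exists s (d : 'I_s -> L), forall z, exists x y : {mpoly k[s]},
    mmap iL d y != 0 /\ z * mmap iL d y = mmap iL d x.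
Proof.
move=> t_gen /choice[p /choice[q pq]] PQ.
pose coefs (g : {mpoly L[n]}) := [seq g@_mu | mu <- msupp g].
pose d := flatten [seq coefs (p j) ++ coefs (q j) | j <- enum 'I_m].
exists (size d), (tnth (in_tuple d)).
pose K0 := {mpoly k[size d]}.
pose i0 : {rmorphism K0 -> L} := mmap iL (tnth (in_tuple d)).
have lift_coef g : {subset coefs g <= d} -> exists g' : {mpoly K0[n]}, map_mpoly i0 g' = g.
  move=> gd; have dP x : x \in d -> exists y : K0, i0 y = x.
    by case/(tnthP (in_tuple d)) => l ->; exists 'X_l; rewrite /i0 /= mmap_mpolyX.
  have /choice[c cE] : forall mu, exists y : K0, mu \in msupp g -> i0 y = g@_mu.
    move=> mu; have [mug|_] := boolP (mu \in msupp g); last by exists 0.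
    by have [|y yE] := dP g@_mu; [apply/gd/map_f | exists y].
  exists (\sum_(mu <- msupp g) c mu *: 'X_[mu]).
  rewrite rmorph_sum /= [RHS]mpolyE big_seq [RHS]big_seq; apply: eq_bigr => mu mug.
  by rewrite map_mpolyZ map_mpolyX cE.
have /choice[p' p'E] : forall j, exists g : {mpoly K0[n]}, map_mpoly i0 g = p j.
  move=> j; apply: lift_coef => x xp.
  apply/flattenP; exists (coefs (p j) ++ coefs (q j)); last by rewrite mem_cat xp.
  by apply: (map_f (fun j => coefs (p j) ++ coefs (q j))); rewrite mem_enum.
have /choice[q' q'E] : forall j, exists g : {mpoly K0[n]}, map_mpoly i0 g = q j.
  move=> j; apply: lift_coef => x xp.
  apply/flattenP; exists (coefs (p j) ++ coefs (q j)); last by rewrite mem_cat xp orbT.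
  by apply: (map_f (fun j => coefs (p j) ++ coefs (q j))); rewrite mem_enum.
have gt g : mmap (i' \o i0) t g = mmap i' t (map_mpoly i0 g) by rewrite mmap_map_mpoly.
have nz (g : {mpoly L[n]}) : g != 0 -> mmap i' t g != 0.
  by apply: contra_neq => /t_gen.
(* With equal points and equal coefficient maps, [spec x x] says that x is a quotient of polynomials
   in t with coefficients in k[d]. *)
pose spec := specializes (i' \o i0) (i' \o i0) t t.
have spec_P P : spec (mmap (i' \o iL) b P) (mmap (i' \o iL) b P).
  apply: spec_mmap => [c|j].
    have -> : (i' \o iL) c = (i' \o i0) c%:MP by rewrite /i0 /= mmap_mpolyC.
    exact: spec_const.
  have [qj0 bj] := pq j.
  by exists (p' j), (q' j); rewrite !gt p'E q'E nz.
move=> z; have [P [Q [Q0 zPQ]]] := PQ z.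
have [u [v [v0 uv _]]] : spec (i' z) (i' z).
  rewrite -[i' z](mulfK Q0) zPQ; apply: specM; first exact: spec_P.
  by apply: specV_neq0 => //; exact: spec_P.
have e : z *: map_mpoly i0 v = map_mpoly i0 u.
  apply: (generic_inj t_gen); rewrite -mul_mpolyC rmorphM /= mmap_mpolyC.
  by rewrite -!gt.
have v0' : map_mpoly i0 v != 0.
  by apply: contra_neq v0 => v0; rewrite gt v0 rmorph0.
exists u@_(mlead (map_mpoly i0 v)), v@_(mlead (map_mpoly i0 v)).
have := congr1 (mcoeff (mlead (map_mpoly i0 v))) e.
rewrite mcoeffZ !mcoeff_map_mpoly => uv'; split=> //.
by move: v0'; rewrite -mleadc_eq0 mcoeff_map_mpoly.
Qed.

(** Here L1 lies between L and L(t). The section s restricted to L has its values at a point b over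
    L1; replacing t by a general c in k^n moves b to a point over L. One c serves all of L because L
    is finitely generated over k ([residue_subfield_finite]). *)
Lemma residue_section_specialize (k L L1 E : fieldType) (iL : {rmorphism k -> L})
    (i1 : {rmorphism L -> L1}) (sigma : {rmorphism L1 -> E}) n (t : 'I_n -> E) :
  infinite_field k -> generic_over (sigma \o i1) t ->
  (forall b, exists p q : {mpoly L[n]},
     q != 0 /\ sigma b * mmap (sigma \o i1) t q = mmap (sigma \o i1) t p) ->
  residue_section (i1 \o iL) -> residue_section iL.
Proof.
move=> k_inf t_gen fracL [m [b [s [sC spec_b]]]].
pose i' : {rmorphism L -> E} := sigma \o i1.
have sigma_b P : sigma (mmap (i1 \o iL) b P) = mmap (i' \o iL) (sigma \o b) P.
  exact: rmorph_mmap.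
have [l [d dP]] : exists l (d : 'I_l -> L), forall z, exists x y : {mpoly k[l]},
    mmap iL d y != 0 /\ z * mmap iL d y = mmap iL d x.
  apply: (residue_subfield_finite (b := sigma \o b) t_gen) => [j|z].
    exact: fracL.
  have [P [Q [Q0 _ PQ]]] := spec_b (i1 z); exists P, Q.
  rewrite -!sigma_b fmorph_eq0; split=> //.
  by rewrite -(rmorphM sigma) PQ.
have /choice[P /choice[Q PQ]] := fun j => spec_b (i1 (d j)).
have /choice[p /choice[q pq]] := fun j => fracL (b j).
have /choice[u /choice[v uv]] := fun j => fracL (mmap (i1 \o iL) b (Q j)).
have u0 j : u j != 0.
  have [Q0 _ _] := PQ j; have [v0 e] := uv j.
  have : mmap i' t (u j) != 0.
    rewrite -e mulf_neq0 ?fmorph_eq0 //; by apply: contra_neq v0 => /t_gen.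
  by apply: contra_neq => ->; rewrite rmorph0.
(* At t = c, q_j keeps b_j regular, while u_j and v_j keep Q_j(b), the denominator for the generator
   d_j, regular and nonzero. *)
have [c] : exists c, mmap idfun (iL \o c) ((\prod_j q j) * \prod_j (u j * v j)) != 0.
  apply: mpoly_nonroot k_inf _; rewrite mulf_neq0 // prodf_seq_neq0; apply/allP => j _ /=.
    by have [] := pq j.
  by have [v0 _] := uv j; rewrite mulf_neq0.
rewrite rmorphM !rmorph_prod mulf_eq0 negb_or.
set ev := mmap idfun (iL \o c).
rewrite !prodf_seq_neq0 => /andP[/allP qc /allP uvc].
have {}qc j : ev (q j) != 0 by apply: qc; rewrite mem_index_enum.
have {}uvc j : ev (u j) != 0 /\ ev (v j) != 0.
  have := uvc j; rewrite mem_index_enum => /(_ isT) /=.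
  by rewrite /ev rmorphM mulf_eq0 negb_or => /andP.
pose b' j := ev (p j) / ev (q j).
pose D := specializes idfun i' t (iL \o c).
have D_b j : D (sigma (b j)) (b' j).
  by have [_ e] := pq j; exists (p j), (q j); rewrite divfK.
have D_P R : D (sigma (mmap (i1 \o iL) b R)) (mmap iL b' R).
  rewrite sigma_b; apply: spec_mmap => // x.
  exact: (@spec_const _ _ _ _ idfun i' t (iL \o c) (iL x)).
have Q0 j : mmap iL b' (Q j) != 0.
  have [uc vc] := uvc j; have [_ e] := uv j.
  suff -> : mmap iL b' (Q j) = ev (u j) / ev (v j) by rewrite mulf_neq0 ?invr_eq0.
  apply: (spec_uniq t_gen (D_P _)).
  by exists (u j), (v j); rewrite divfK.
have PQ' j : d j * mmap iL b' (Q j) = mmap iL b' (P j).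
  apply: (spec_uniq t_gen _ (D_P (P j))); have [_ _ <-] := PQ j.
  rewrite rmorphM; apply: specM; last exact: D_P.
  exact: (@spec_const _ _ _ _ idfun i' t (iL \o c) (d j)).
exists m, b', (s \o i1); split=> [a|z]; first exact: sC.
have gen := @rfX_generic k m.
pose spec := specializes iL (@rfC k m) (@rfX k m) b'.
have spec_d j : spec (s (i1 (d j))) (d j).
  by exists (P j), (Q j); have [_ e _] := PQ j; split.
have spec_P R : spec ((s \o i1) (mmap iL d R)) (mmap iL d R).
  rewrite rmorph_mmap; apply: spec_mmap => // a.
  by rewrite [X in specializes _ _ _ _ X](sC a); apply: spec_const.
have [x [y [y0 zxy]]] := dP z.
rewrite -[z](mulfK y0) zxy fmorph_div; apply: specM; first exact: spec_P.
by apply: specV => //; exact: spec_P.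
Qed.

(** * Galois descent: Dedekind independence and Speiser's theorem *)

Definition faithful_field_action (gT : finGroupType) (G : {group gT})
    (N : fieldType) (act : gT -> {rmorphism N -> N}) : Prop :=
  [/\ forall x, act 1%g x = x,
      {in G &, forall g h x, act (g * h)%g x = act g (act h x)}
    & {in G, forall g, (forall x, act g x = x) -> g = 1%g}].

Section GaloisDescent.

Variables (gT : finGroupType) (G : {group gT}) (N : fieldType).
Variable act : gT -> {rmorphism N -> N}.
Hypothesis act_faithful : faithful_field_action G act.

Lemma field_action_eq g h :
  g \in G -> h \in G -> (forall x, act g x = act h x) -> g = h.
Proof.
case: act_faithful => act1 actM act_f Gg Gh gh.
apply: (mulgI h^-1%g); rewrite mulVg; apply: act_f; first by rewrite groupM ?groupV.
by move=> x; rewrite actM ?groupV // gh -actM ?groupV // mulVg act1.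
Qed.

(** A relation with nonzero coefficients at h and g0 can be shortened: choose y with h(y) != g0(y),
    evaluate at y x and subtract g0(y) times the relation at x. The coefficient at g0 disappears,
    the one at h does not. *)
Lemma dedekind_independence (c : gT -> N) :
  (forall x, \sum_(g in G) c g * act g x = 0) -> {in G, forall g, c g = 0}.
Proof.
move: {2}#|_| (leqnn #|[set g in G | c g != 0]|) => n.
elim: n c => [|n IHn] c supp_c c0 g0 Gg0; apply/eqP/negPn/negP => cg0.
  move: supp_c; rewrite leqn0 cards_eq0 => /eqP /setP /(_ g0).
  by rewrite !inE Gg0 cg0.
have [h /and3P[Gh ch hg0]|no_h] :=
  pickP (fun h => [&& h \in G, c h != 0 & h != g0]); last first.
  have := c0 1; rewrite (bigD1 g0) //= rmorph1 mulr1 big1 ?addr0; first by apply/eqP.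
  move=> g /andP[Gg gg0]; have := no_h g; rewrite Gg gg0 andbT /= => /negbFE /eqP ->.
  by rewrite mul0r.
have [y ghy] : exists y, act h y != act g0 y.
  apply: contra_notP (elimN eqP hg0) => noy; apply: field_action_eq => // y.
  by apply/eqP/negPn/negP => yP; apply: noy; exists y.
suff /(_ h Gh)/eqP : {in G, forall g, c g * (act g y - act g0 y) = 0}.
  by rewrite mulf_eq0 subr_eq0 (negPf ch) (negPf ghy).
apply: IHn => [|x].
  rewrite -ltnS; apply: leq_trans supp_c; apply: proper_card; apply/properP; split.
    by apply/subsetP => g; rewrite !inE mulf_eq0 negb_or => /and3P[-> ->].
  by exists g0; rewrite !inE Gg0 // subrr mulr0 eqxx.
transitivity (\sum_(g in G) c g * act g (y * x)
              - act g0 y * \sum_(g in G) c g * act g x).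
  rewrite mulr_sumr -sumrB; apply: eq_bigr => g _.
  by rewrite rmorphM mulrBr mulrBl !mulrA [c g * act g0 y]mulrC.
by rewrite !c0 mulr0 subrr.
Qed.

Section Speiser.

Variables (q : nat) (pi : gT -> 'I_q -> 'I_q) (w : gT -> 'I_q -> N).
Hypothesis pi1 : forall j, pi 1%g j = j.
Hypothesis piM : {in G &, forall g h j, pi (g * h)%g j = pi g (pi h j)}.
Hypothesis w_neq0 : {in G, forall g j, w g j != 0}.
Hypothesis wM :
  {in G &, forall g h j, w (g * h)%g j = act g (w h j) * w g (pi h j)}.

(** Invariant rows of the semilinear action of G on N^q given by the permutations pi and the cocycle
    w. *)
Definition twisted_fixed (v : 'rV[N]_q) : Prop :=
  {in G, forall g j, act g (v 0 j) = w g j * v 0 (pi g j)}.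

(** Averaging c times the basis row j0 over G gives an invariant row whose product with lambda is a
    combination of the g(c). Its coefficient at g = 1 involves lambda_j0 != 0, so Dedekind
    independence gives a suitable c. *)
Lemma twisted_fixed_separates (lambda : 'cV[N]_q) :
  lambda != 0 -> exists2 v, twisted_fixed v & v *m lambda != 0.
Proof.
move=> lambda0; have [j0 lj0] : exists j, lambda j 0 != 0.
  apply: contra_neqP lambda0 => no_j; apply/matrixP => j l; rewrite ord1 mxE.
  by apply/eqP/negPn/negP => lj; apply: no_j; exists j.
have piVK h j : h \in G -> pi h^-1%g (pi h j) = j.
  by move=> Gh; rewrite -piM ?groupV // mulVg pi1.
pose V c : 'rV[N]_q := \row_j \sum_(g in G | pi g j0 == j) (w g j0)^-1 * act g c.
have [c Vc] : exists c, V c *m lambda != 0.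
  have [//|noc] := pselect (exists c, V c *m lambda != 0).
  have /(_ 1%g (group1 G))/eqP : {in G, forall g, (w g j0)^-1 * lambda (pi g j0) 0 = 0}.
    apply: dedekind_independence => c.
    have /matrixP/(_ 0 0) : V c *m lambda = 0.
      by apply/eqP/negPn/negP => Vc; apply: noc; exists c.
    rewrite !mxE => {2}<-; rewrite (partition_big (pi^~ j0) xpredT) //=.
    apply: eq_bigr => j _; rewrite mxE mulr_suml; apply: eq_bigr => g /andP[_ /eqP->].
    by rewrite mulrAC.
  by rewrite mulf_eq0 invr_eq0 pi1 (negPf lj0) (negPf (w_neq0 (group1 G) j0)).
exists (V c) => // h Gh j; rewrite !mxE rmorph_sum mulr_sumr.
rewrite [RHS](reindex_inj (mulgI h)) /=.
apply: eq_big => [g|g /andP[Gg /eqP gj]].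
  rewrite groupMl //; case Gg: (g \in G) => //=; rewrite piM //.
  apply/eqP/eqP => [->//|e].
  by rewrite -[LHS](piVK h) // e piVK.
rewrite rmorphM fmorphV wM // gj invfM mulrA mulrCA.
case: act_faithful => _ -> // _; rewrite divff ?mulr1 //; exact: w_neq0.
Qed.

(** Speiser's theorem. Given r < q independent invariant rows, an invariant row not annihilated by
    some lambda that annihilates them all is independent of them. *)
Lemma twisted_fixed_basis : exists2 C : 'M[N]_q, C \in unitmx &
  {in G, forall g i j, act g (C i j) = w g j * C i (pi g j)}.
Proof.
suff [C C_free fixC] : exists2 C : 'M[N]_q, row_free C & forall i, twisted_fixed (row i C).
  exists C; first by rewrite -row_free_unit.
  by move=> g Gg i j; have := fixC i g Gg j; rewrite !mxE.
suff: forall r, (r <= q)%N -> exists2 C : 'M[N]_(r, q), row_free C &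
    forall i, twisted_fixed (row i C) by apply.
elim=> [_|r IHr rq]; first by exists 0; [rewrite -row_leq_rank | case].
have [C C_free fixC] := IHr (ltnW rq).
have [lambda [lambda0 Cl]] : exists l : 'cV[N]_q, l != 0 /\ C *m l = 0.
  have K0 : cokermx C != 0.
    by rewrite -mxrank_eq0 mxrank_coker subn_eq0 -ltnNge (eqP C_free).
  have [j Kj] : exists j, col j (cokermx C) != 0.
    apply: contra_neqP K0 => no_j; apply/matrixP => i j; rewrite [RHS]mxE.
    have /matrixP/(_ i 0) : col j (cokermx C) = 0.
      by apply/eqP/negPn/negP => Kj; apply: no_j; exists j.
    by rewrite !mxE.
  exists (col j (cokermx C)); split=> //.
  by rewrite colE mulmxA mulmx_coker mul0mx.
have [v fixv vl] := twisted_fixed_separates lambda0.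
have vC_free : row_free (col_mx v C).
  apply: inj_row_free => u; rewrite -[u]hsubmxK mul_row_col => u0.
  have ul : lsubmx u = 0.
    have := congr1 (mulmx^~ lambda) u0.
    rewrite /= mulmxDl -!mulmxA Cl mulmx0 addr0 mul0mx => /matrixP /(_ 0 0) /eqP.
    rewrite [lsubmx u]mx11_scalar mul_scalar_mx; set a := lsubmx u 0 0.
    rewrite mxE [X in _ == X]mxE mulf_eq0.
    case/orP => [/eqP -> |vl0]; first exact: raddf0.
    case/eqP: vl; apply/matrixP => i j; rewrite !ord1 [RHS]mxE; exact/eqP.
  move: u0; rewrite ul mul0mx add0r => uC.
  by rewrite (row_free_inj C_free (_ : rsubmx u *m C = 0 *m C)) ?row_mx0 // mul0mx.
suff fixvC (i : 'I_(1 + r)) : twisted_fixed (row i (col_mx v C)).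
  by exists (col_mx v C).
case: (split_ordP i) => j ->.
  by rewrite rowKu [j]ord1 row_id.
by rewrite rowKd.
Qed.

End Speiser.
End GaloisDescent.

(* The homomorphism Z^n -> F^* with values h on the standard basis, composed  *)
(* with the matrix u.                                                         *)
Definition monomials (F : fieldType) n m (h : 'I_n -> F) (u : 'M[int]_(n, m)) :
    'I_m -> F :=
  fun j => \prod_(i < n) h i ^ u i j.

(** * Calculus of monomials with integer exponents *)

Section Monomials.

Variables (F : fieldType) (n : nat).
Implicit Types h : 'I_n -> F.

Lemma monomials_neq0 m h (u : 'M_(n, m)) j :
  (forall i, h i != 0) -> monomials h u j != 0.
Proof.
by move=> h0; rewrite prodf_seq_neq0; apply/allP => i _ /=; rewrite expfz_neq0.
Qed.

Lemma monomialsM m h1 h2 (u : 'M_(n, m)) j :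
  monomials (fun i => h1 i * h2 i) u j = monomials h1 u j * monomials h2 u j.
Proof. by rewrite -big_split; apply: eq_bigr => i _; rewrite expfzMl. Qed.

Lemma monomialsV m h (u : 'M_(n, m)) j :
  monomials (fun i => (h i)^-1) u j = (monomials h u j)^-1.
Proof. by rewrite -prodfV; apply: eq_bigr => i _; rewrite exprz_inv invr_expz. Qed.

Lemma monomialsD m h (u v : 'M_(n, m)) j : (forall i, h i != 0) ->
  monomials h (u + v) j = monomials h u j * monomials h v j.
Proof.
move=> h0; rewrite -big_split; apply: eq_bigr => i _.
by rewrite mxE expfzDr.
Qed.

Lemma monomials0 m h j : monomials h (0 : 'M_(n, m)) j = 1.
Proof. by apply: big1 => i _; rewrite mxE expr0z. Qed.

Lemma monomials_delta m h (u : 'M_(n, m)) j l :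
  (forall i, u i j = (i == l)%:Z) -> monomials h u j = h l.
Proof.
move=> uE; rewrite /monomials (bigD1 l) //= uE eqxx expr1z big1 ?mulr1 // => i.
by move=> /negPf il; rewrite uE il expr0z.
Qed.

Lemma monomials1 h : monomials h 1%:M = h.
Proof. by apply/funext => j; apply: monomials_delta => i; rewrite mxE natz. Qed.

Lemma monomials_morph (F' : fieldType) (phi : {rmorphism F -> F'}) m h
    (u : 'M_(n, m)) j :
  phi (monomials h u j) = monomials (phi \o h) u j.
Proof. by rewrite rmorph_prod; apply: eq_bigr => i _; rewrite fmorphXz. Qed.

Lemma monomials_comp m l h (u : 'M_(n, m)) (v : 'M_(m, l)) :
  (forall i, h i != 0) -> monomials (monomials h u) v = monomials h (u *m v).
Proof.
move=> h0; apply/funext => j.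
have expz_prod (a : int) (x : 'I_n -> F) : (\prod_i x i) ^ a = \prod_i x i ^ a.
  exact: (big_morph (fun x => x ^ a) (fun x y => expfzMl x y a) (exp1rz _ a)).
rewrite /monomials; under eq_bigr => i _ do rewrite expz_prod.
rewrite exchange_big; apply: eq_bigr => i _ /=.
rewrite mxE; elim/big_rec2: _ => [|a x y _ ->]; first by rewrite expr0z.
by rewrite expfzDr // exprz_exp.
Qed.

End Monomials.

(** * Hilbert 90 and extension of equivariant homomorphisms *)

Section EquivariantExtension.

Variables (gT : finGroupType) (G : {group gT}) (F : fieldType).
Variable act : gT -> {rmorphism F -> F}.
Hypothesis act_faithful : faithful_field_action G act.
Variables (k : fieldType) (iF : {rmorphism k -> F}).
Hypothesis k_infinite : infinite_field k.
Hypothesis act_k : {in G, forall g c, act g (iF c) = iF c}.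

(** Each invariant row splits w, except that its entries may vanish. Combining the rows of an
    invariant basis with coefficients c^i, for c in k, keeps invariance, and the entries are nonzero
    once c avoids the roots of the r_j. *)
Lemma monomial_hilbert90 q (pi : gT -> 'I_q -> 'I_q) (w : gT -> 'I_q -> F) :
  (forall j, pi 1%g j = j) ->
  {in G &, forall g h j, pi (g * h)%g j = pi g (pi h j)} ->
  {in G, forall g j, w g j != 0} ->
  {in G &, forall g h j, w (g * h)%g j = act g (w h j) * w g (pi h j)} ->
  exists2 y : 'I_q -> F, forall j, y j != 0 &
    {in G, forall g j, act g (y j) = w g j * y (pi g j)}.
Proof.
move=> pi1 piM w0 wM.
have [C C_unit fixC] := twisted_fixed_basis act_faithful pi1 piM w0 wM.
pose r j : {poly F} := \sum_(i < q) C i j *: 'X^i.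
have r0 j : r j != 0.
  apply/eqP => rj0; have Cj0 i : C i j = 0.
    have := congr1 (coefp i) rj0; rewrite /= coef0 coef_sum (bigD1 i) //=.
    rewrite coefZ coefXn eqxx mulr1 big1 ?addr0 // => l li.
    by rewrite coefZ coefXn eq_sym (negPf (li : (l : nat) != i)) mulr0.
  have /matrixP/(_ j j) := mulVmx C_unit; rewrite !mxE eqxx big1 => [/eqP|i _].
    by rewrite eq_sym oner_eq0.
  by rewrite Cj0 mulr0.
have [|c] := @poly_nonroot k F iF (\prod_j r j) k_infinite.
  by rewrite prodf_seq_neq0; apply/allP => j _ /=.
rewrite horner_prod prodf_seq_neq0 => /allP rc.
have rE j : (r j).[iF c] = \sum_(i < q) iF c ^+ i * C i j.
  by rewrite horner_sum; apply: eq_bigr => i _; rewrite hornerZ hornerXn mulrC.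
exists (fun j => (r j).[iF c]) => [j|g Gg j].
  by have := rc j; rewrite mem_index_enum; apply.
rewrite !rE rmorph_sum mulr_sumr; apply: eq_bigr => i _.
by rewrite rmorphM rmorphXn /= act_k // fixC // mulrCA.
Qed.

Lemma extend_equivariant m p f q (rM : glattice G m) (rP : glattice G p)
    (rF : glattice G f) (pi : gT -> 'I_q -> 'I_q)
    (i : 'M[int]_(p, m)) (r : 'M[int]_(m, p))
    (e : 'M[int]_(f, p)) (s : 'M[int]_(p, f))
    (alpha : 'M[int]_(q, f)) (beta : 'M[int]_(f, q)) (phi : 'I_m -> F) :
  lattice_hom rM rP i -> lattice_hom rP rF e ->
  e *m i = 0 -> e *m s = 1%:M -> r *m i = 1%:M -> i *m r + s *m e = 1%:M ->
  (forall j, pi 1%g j = j) ->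
  {in G &, forall g h j, pi (g * h)%g j = pi g (pi h j)} ->
  let Pi g : 'M[int]_q := \matrix_(a, b) (a == pi g b)%:Z in
  {in G, forall g, alpha *m rF g = Pi g *m alpha} ->
  {in G, forall g, beta *m Pi g = rF g *m beta} ->
  beta *m alpha = 1%:M ->
  (forall j, phi j != 0) ->
  {in G, forall g j, act g (phi j) = monomials phi (rM g) j} ->
  exists h : 'I_p -> F,
    [/\ forall j, h j != 0,
        {in G, forall g j, act g (h j) = monomials h (rP g) j}
      & monomials h i = phi].
Proof.
move=> iP eF ei es ri ir_se pi1 piM Pi alphaP betaP ba phi0 phiM.
have [act1 actM _] := act_faithful.
have actV g (h : 'I_p -> F) : (forall j, h j != 0) -> forall j, (act g \o h) j != 0.
  by move=> h0 j; rewrite fmorph_eq0.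
have monPi (h : 'I_q -> F) g j : monomials h (Pi g) j = h (pi g j).
  by apply: monomials_delta => a; rewrite mxE.
pose u := monomials phi r.
have u0 j : u j != 0 by apply: monomials_neq0.
have ui : monomials u i = phi by rewrite /u monomials_comp // ri monomials1.
(* c measures how far the linear extension u of phi is from being             *)
(* equivariant; it factors through e as a cocycle z with values in the dual   *)
(* of F, which Hilbert 90 splits after pulling back to the permutation module.*)
pose c g j := act g (u j) / monomials u (rP g) j.
have mPu g j : monomials u (rP g) j != 0 by apply: monomials_neq0.
have c0 g j : c g j != 0 by rewrite mulf_neq0 ?invr_eq0 // actV.
have c_i g : g \in G -> monomials (c g) i = fun=> 1.
  move=> Gg; apply/funext => j; rewrite /c monomialsM monomialsV.
  rewrite (monomials_comp _ _ u0) -iP // -monomials_comp // ui -phiM // -ui.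
  by rewrite (monomials_morph (act g)) divff // monomials_neq0 // => l; apply: actV.
have c_se g : g \in G -> monomials (monomials (c g) s) e = c g.
  move=> Gg; apply/funext => j; rewrite monomials_comp //.
  rewrite -[RHS](congr1 (@^~ j) (monomials1 (c g))) -ir_se monomialsD //.
  rewrite -(monomials_comp i) // c_i // -[LHS]mul1r; congr (_ * _).
  by apply/esym/big1 => l _; rewrite exp1rz.
have cM : {in G &, forall g h j,
    c (g * h)%g j = act g (c h j) * monomials (c g) (rP h) j}.
  move=> g h Gg Gh j; rewrite /c fmorph_div monomialsM monomialsV actM //.
  rewrite (monomials_comp _ _ u0) -repr_mxM // (monomials_morph (act g)) mulrA.
  by rewrite divfK // monomials_neq0 // => l; apply: actV.
pose z g := monomials (c g) s.
have z0 g j : z g j != 0 by apply: monomials_neq0.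
have zM : {in G &, forall g h j,
    z (g * h)%g j = act g (z h j) * monomials (z g) (rF h) j}.
  move=> g h Gg Gh j; rewrite /z (monomials_morph (act g)).
  have -> : c (g * h)%g = fun l => (act g \o c h) l * monomials (c g) (rP h) l.
    by apply/funext => l; rewrite cM.
  rewrite monomialsM; congr (_ * _); rewrite -[c g in LHS]c_se //.
  rewrite -/(z g) !(monomials_comp _ _ (z0 g)) eF //.
  by rewrite -mulmxA es mulmx1.
pose w g := monomials (z g) beta.
have w0 g j : w g j != 0 by apply: monomials_neq0.
have wM : {in G &, forall g h j, w (g * h)%g j = act g (w h j) * w g (pi h j)}.
  move=> g h Gg Gh j; rewrite /w (monomials_morph (act g)).
  have -> : z (g * h)%g = fun l => (act g \o z h) l * monomials (z g) (rF h) l.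
    by apply/funext => l; rewrite zM.
  rewrite monomialsM; congr (_ * _); rewrite -monPi !(monomials_comp _ _ (z0 g)).
  by rewrite betaP.
have [y y0 yM] := monomial_hilbert90 pi1 piM (in1W w0) wM.
pose x := monomials y alpha.
have x0 j : x j != 0 by apply: monomials_neq0.
have xM : {in G, forall g j, act g (x j) = z g j * monomials x (rF g) j}.
  move=> g Gg j; rewrite /x (monomials_morph (act g)).
  have -> : act g \o y = fun l => w g l * monomials y (Pi g) l.
    by apply/funext => l; rewrite /= yM // monPi.
  rewrite monomialsM /w (monomials_comp _ _ (z0 g)) !(monomials_comp _ _ y0).
  rewrite ba monomials1; congr (_ * _).
  by rewrite alphaP.
(* Dividing by the pullback of x along e makes u equivariant and does not change it on M, as e i =
   0. *)
exists (fun j => u j / monomials x e j); split=> [j|g Gg j|].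
- by rewrite mulf_neq0 ?invr_eq0 ?monomials_neq0.
- rewrite fmorph_div (monomials_morph (act g) x) monomialsM monomialsV.
  have -> : act g \o x = fun l => z g l * monomials x (rF g) l.
    by apply/funext => l; rewrite /= xM.
  rewrite monomialsM /z c_se // !(monomials_comp _ _ x0) -eF //.
  have -> : act g (u j) = c g j * monomials u (rP g) j by rewrite divfK.
  by rewrite invfM mulrACA divff ?mul1r.
apply/funext => j; rewrite monomialsM monomialsV (monomials_comp _ _ x0) ei.
by rewrite monomials0 divr1 ui.
Qed.

End EquivariantExtension.

(** * Function fields of lattices and maps between them *)

Section RationalFunctionMorphisms.

Variables (k : fieldType) (n : nat).

Lemma eq_ratfun_hom (E : fieldType) (f g : {rmorphism ratfun k n -> E}) :
  (forall c, f (rfC n c) = g (rfC n c)) ->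
  (forall i, f (rfX k i) = g (rfX k i)) -> f =1 g.
Proof.
move=> fgC fgX z; rewrite (ratfunE z) !fmorph_div.
have fgP p : f (rfP p) = g (rfP p).
  have := eq_mmap fgC fgX p.
  rewrite -(mpoly_morph_mmap (f \o @rfP k n)).
  by rewrite -(mpoly_morph_mmap (g \o @rfP k n)).
by rewrite !fgP.
Qed.

Lemma monomials_inj m (u v : 'M[int]_(n, m)) j :
  monomials (@rfX k n) u j = monomials (@rfX k n) v j -> forall i, u i j = v i j.
Proof.
(* Multiplication by the monomial s makes all exponents nonnegative, so that the two sides can be
   compared as polynomials. *)
move=> uv; pose s : 'cV[int]_n := \col_i (`|u i j| + `|v i j|)%N%:Z.
pose a i := absz (u i j + s i 0); pose b i := absz (v i j + s i 0).
have abs_ge (x y : int) : 0 <= x + (`|x| + `|y|)%N%:Z.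
  by rewrite PoszD addrA addr_ge0 // -lerBlDl sub0r abszE -normrN ler_norm.
have aE i : (a i)%:Z = u i j + s i 0 by rewrite /a gez0_abs // mxE.
have bE i : (b i)%:Z = v i j + s i 0 by rewrite /b gez0_abs // mxE addnC.
have mE (c : 'I_n -> nat) (w : 'M[int]_(n, m)) : (forall i, (c i)%:Z = w i j + s i 0) ->
    monomials (@rfX k n) w j * rf_monomial k s = rfP 'X_[[multinom c i | i < n]].
  move=> cE; rewrite -(@rf_monomial_nat _ _ _ (col j w + s)) => [|i].
    by rewrite rf_monomialD; congr (_ * _); apply: eq_bigr => i _; rewrite mxE.
  by rewrite mnmE cE !mxE.
have /rfP_inj/(congr1 (mcoeff [multinom a i | i < n]))/eqP :
    rfP 'X_[[multinom a i | i < n]] = rfP 'X_[[multinom b i | i < n]] :> ratfun k n.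
  by rewrite -(mE _ _ aE) -(mE _ _ bE) uv.
rewrite !mcoeffX eqxx; have [ba _ i|_] := eqVneq [multinom b i | i < n] _;
  last by rewrite oner_eq0.
have := congr1 (fun m : 'X_{1..n} => m i) ba; rewrite !mnmE => bai.
by apply: (addIr (s i 0)); rewrite -aE -bE bai.
Qed.

(* The involution [0, v; u, 1 - uv] of Z^(n + m) embeds Z^n as u (Z^n), which *)
(* reduces the claim to the case of a unimodular matrix.                      *)
Lemma monomials_generic m (u : 'M[int]_(m, n)) (v : 'M[int]_(n, m)) :
  v *m u = 1%:M -> generic_over (@rfC k m) (monomials (@rfX k m) u).
Proof.
move=> vu; pose W : 'M[int]_(n + m) := block_mx 0 v u (1%:M - u *m v).
have WW : W *m W = 1%:M.
  rewrite mulmx_block !mul0mx !add0r vu mulmxBr mulmx1 mulmxA vu mul1mx subrr.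
  rewrite mulmx0 add0r mulmxBl mul1mx -!mulmxA vu mulmx1 subrr mulmxBl !mul1mx.
  rewrite mulmxBr mulmx1 -mulmxA (mulmxA v) vu mul1mx subrr subr0 addrC subrK.
  by rewrite -scalar_mx_block.
have W_gen : generic_over (@rfC k (n + m)) (monomials (@rfX k (n + m)) W).
  move=> p p0; apply: (@alg_indep_monomial k _ W W WW).
  rewrite -[RHS]p0; apply: eq_mmap => // j; apply: eq_bigr => i _.
  by rewrite mxE.
have [wid [widC widX]] :=
  ratfun_hom (generic_sub (@rshift_inj n m) (@rfX_generic k (n + m))).
move=> p p0; apply: (generic_sub (@lshift_inj n m) W_gen).
rewrite -(rmorph0 wid) -p0 rmorph_mmap; apply: eq_mmap => [c|j] /=.
  by rewrite widC.
rewrite monomials_morph /monomials big_split_ord /= big1 ?mul1r => [|i _].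
  by apply: eq_bigr => i _; rewrite /= widX /W block_mxEdl.
by rewrite /W block_mxEul mxE expr0z.
Qed.

End RationalFunctionMorphisms.

Lemma lattice_map_exists (k : fieldType) m n (u : 'M[int]_(m, n)) (v : 'M[int]_(n, m)) :
  v *m u = 1%:M -> exists mu : {rmorphism ratfun k n -> ratfun k m},
    (forall c, mu (rfC n c) = rfC m c) /\
    (forall j, mu (rfX k j) = monomials (@rfX k m) u j).
Proof. by move=> vu; exact: ratfun_hom (monomials_generic vu). Qed.

Lemma lattice_map_monomials (k : fieldType) m n l (u : 'M[int]_(m, n))
    (mu : {rmorphism ratfun k n -> ratfun k m}) (w : 'M[int]_(n, l)) :
  (forall j, mu (rfX k j) = monomials (@rfX k m) u j) ->
  forall j, mu (monomials (@rfX k n) w j) = monomials (@rfX k m) (u *m w) j.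
Proof.
move=> muX j; rewrite monomials_morph -monomials_comp; last exact: rfX_neq0.
by congr (monomials _ _ _); apply/funext => i /=.
Qed.

Section LatticeAction.

Variables (k : fieldType) (gT : finGroupType) (G : {group gT}) (n : nat).
Variable rM : glattice G n.

Lemma lattice_act_exists : {act : gT -> {rmorphism ratfun k n -> ratfun k n} |
  {in G, forall g z, act g z = rf_subst (lattice_action k rM g) z}}.
Proof.
apply: cid; suff /choice[act actP] : forall g,
    exists f : {rmorphism ratfun k n -> ratfun k n},
    g \in G -> forall z, f z = rf_subst (lattice_action k rM g) z.
  by exists act => g Gg z; apply: actP.
(* Algebraic independence of the images is known for g in G only; the identity is a default value
   elsewhere. *)
move=> g; have [Gg|_] := boolP (g \in G); last by exists idfun.
have free := rf_image_free (r := lattice_action k rM) Gg.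
have [||f fE] := @rmorphism_of _ _ (rf_subst (lattice_action k rM g)).
- exact: rf_subst_sub.
- by split; [exact: rf_subst1 | exact: rf_subst_mul].
by exists f.
Qed.

Definition lattice_act : gT -> {rmorphism ratfun k n -> ratfun k n} :=
  sval lattice_act_exists.

Lemma lattice_actE : {in G, forall g z,
  lattice_act g z = rf_subst (lattice_action k rM g) z}.
Proof. exact: (svalP lattice_act_exists). Qed.

Lemma lattice_actC : {in G, forall g c, lattice_act g (rfC n c) = rfC n c}.
Proof. by move=> g Gg c; rewrite lattice_actE // rf_substC //; exact: rf_image_free. Qed.

Lemma lattice_actX : {in G, forall g j,
  lattice_act g (rfX k j) = monomials (@rfX k n) (rM g) j}.
Proof.
move=> g Gg j; rewrite lattice_actE // rf_substX; last exact: rf_image_free.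
by apply: eq_bigr => i _; rewrite mxE.
Qed.

Lemma lattice_act_faithful : mx_faithful rM -> faithful_field_action G lattice_act.
Proof.
move=> rM_faithful; split.
- apply: (eq_ratfun_hom (g := idfun)) => [c|j] /=; first by rewrite lattice_actC.
  by rewrite lattice_actX // repr_mx1 monomials1.
- move=> g h Gg Gh.
  apply: (eq_ratfun_hom (g := lattice_act g \o lattice_act h)) => [c|j] /=.
    by rewrite !lattice_actC // groupM.
  rewrite !lattice_actX ?groupM // (lattice_map_monomials (u := rM g)).
    by rewrite repr_mxM.
  exact: lattice_actX.
move=> g Gg actg; apply/set1P; apply: (subsetP rM_faithful).
apply/rkerP; split=> //; apply/matrixP => i j; apply: (@monomials_inj k).
by rewrite -lattice_actX // actg monomials1.
Qed.

Lemma lattice_fixedP z :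
  reflect {in G, forall g, lattice_act g z = z} (z \in rf_fixed (lattice_action k rM)).
Proof.
apply: (iffP (rf_fixedP _ _)) => fz g Gg; first by rewrite lattice_actE // fz.
by rewrite -lattice_actE // fz.
Qed.

End LatticeAction.

Section LatticeMap.

Variables (k : fieldType) (gT : finGroupType) (G : {group gT}) (n m : nat).
Variables (rM : glattice G n) (rN : glattice G m) (u : 'M[int]_(m, n)).
Variable mu : {rmorphism ratfun k n -> ratfun k m}.
Hypothesis u_hom : lattice_hom rM rN u.
Hypothesis muC : forall c, mu (rfC n c) = rfC m c.
Hypothesis muX : forall j, mu (rfX k j) = monomials (@rfX k m) u j.

Lemma lattice_map_act : {in G, forall g z,
  mu (lattice_act k rM g z) = lattice_act k rN g (mu z)}.
Proof.
move=> g Gg.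
apply: (eq_ratfun_hom (f := mu \o lattice_act k rM g)
                      (g := lattice_act k rN g \o mu)) => [c|j] /=.
  by rewrite lattice_actC // !muC lattice_actC.
rewrite muX lattice_actX // (lattice_map_monomials _ muX) u_hom //.
by rewrite -(lattice_map_monomials (mu := lattice_act k rN g)) //; exact: lattice_actX.
Qed.

Lemma lattice_map_fixed :
  exists nu : {rmorphism fixed_field (lattice_action k rM)
                      -> fixed_field (lattice_action k rN)},
    (forall z, val (nu z) = mu (val z)) /\
    (forall c, nu (fixedC (lattice_action k rM) c) = fixedC (lattice_action k rN) c).
Proof.
have mu_fixed (z : fixed_field (lattice_action k rM)) :
    mu (val z) \in rf_fixed (lattice_action k rN).
  apply/lattice_fixedP => g Gg; rewrite -lattice_map_act //; congr (mu _).
  by apply/(lattice_fixedP rM _) => //; case: z.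
have [||nu nuE] := @rmorphism_of _ _ (fun z => FixedField (mu_fixed z)).
- by move=> y z; apply: val_inj; rewrite /= rmorphB.
- by split=> [|y z]; apply: val_inj; rewrite /= ?rmorph1 ?rmorphM.
exists nu; split=> [z|c]; first by rewrite nuE.
by rewrite nuE; apply: val_inj; rewrite /= muC.
Qed.

End LatticeMap.

Lemma map_mpoly_inj n (R S : nzRingType) (f : {rmorphism R -> S}) :
  injective f -> injective (@map_mpoly n R S f).
Proof.
move=> f_inj p q /mpolyP pq; apply/mpolyP => m; apply: f_inj.
by rewrite -!mcoeff_map_mpoly.
Qed.

(** The identification of k[n + p] with k[n][p] maps k(n + p) to k(n)(p), where the last p variables
    are generic over the constants k(n). *)
Lemma rfX_block_generic (k : fieldType) n p
    (iota : {rmorphism ratfun k n -> ratfun k (n + p)}) :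
  (forall c, iota (rfC n c) = rfC (n + p) c) ->
  (forall j, iota (rfX k j) = rfX k (lshift p j)) ->
  generic_over iota (fun j => rfX k (rshift n j)).
Proof.
move=> iotaC iotaX.
pose N := ratfun k n; pose R := {mpoly k[n]}.
pose iE : {rmorphism k -> ratfun N p} := @rfC N p \o @rfC k n.
pose h (i : 'I_(n + p)) : ratfun N p :=
  match split i with inl j => rfC p (rfX k j) | inr j => rfX N j end.
pose h' (i : 'I_(n + p)) : {mpoly R[p]} :=
  match split i with inl j => ('X_j)%:MP | inr j => 'X_j end.
pose Psi : {rmorphism {mpoly k[n + p]} -> {mpoly R[p]}} :=
  mmap (@mpolyC p R \o @mpolyC n k) h'.
pose emb : {rmorphism R -> {mpoly k[n + p]}} :=
  mmap (@mpolyC (n + p) k) (fun j => 'X_(lshift p j)).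
pose Phi : {rmorphism {mpoly R[p]} -> {mpoly k[n + p]}} :=
  mmap emb (fun j => 'X_(rshift n j)).
have PsiK : cancel Psi Phi.
  move=> P; rewrite /Psi /= rmorph_mmap [RHS](mpoly_morph_mmap idfun).
  apply: eq_mmap => [c|i] /=; first by rewrite /Phi /= mmap_mpolyC /emb /= mmap_mpolyC.
  rewrite /h'; case: (split_ordP i) => j -> /=.
    by rewrite mmap_mpolyC /= mmap_mpolyX.
  by rewrite mmap_mpolyX.
have h_gen : generic_over iE h.
  move=> P P0; apply: (can_inj PsiK); rewrite rmorph0.
  apply: (map_mpoly_inj (@rfP_inj k n)); apply: (@rfP_inj N p).
  rewrite !rmorph0 -[RHS]P0 /map_mpoly !rmorph_mmap.
  apply: eq_mmap => [c|i] /=.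
    by rewrite mmap_mpolyC.
  rewrite /h /h'; case: split => j; last by rewrite mmap_mpolyX.
  by rewrite mmap_mpolyC.
have [theta [thetaC thetaX]] := ratfun_hom h_gen.
move=> Q Q0; apply: (@rfX_generic N p); rewrite -(rmorph0 theta) -Q0 rmorph_mmap.
apply: eq_mmap => [c|j] /=; last by rewrite thetaX /h (unsplitK (inr j)).
apply: (eq_ratfun_hom (f := @rfC N p) (g := theta \o iota)) => [a|j] /=.
  by rewrite iotaC thetaC.
by rewrite iotaX thetaX /h (unsplitK (inl j)).
Qed.

(** * Descent of specializations to fixed fields *)

Section Descent.

Variables (gT : finGroupType) (G : {group gT}) (N F E : fieldType).
Variables (aN : gT -> {rmorphism N -> N}) (aF : gT -> {rmorphism F -> F}).
Variables (aE : gT -> {rmorphism E -> E}).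
Variables (i : {rmorphism N -> F}) (i' : {rmorphism N -> E}).
Hypothesis aN1 : forall x, aN 1%g x = x.
Hypothesis aNM : {in G &, forall g h x, aN (g * h)%g x = aN g (aN h x)}.
Hypothesis i_act : {in G, forall g x, i (aN g x) = aF g (i x)}.
Hypothesis i'_act : {in G, forall g x, i' (aN g x) = aE g (i' x)}.
Variables (L : fieldType) (iN : {rmorphism L -> N}).
Hypothesis iN_fixed : forall x, {in G, forall g, aN g x = x} -> exists l, iN l = x.

Lemma mpoly_fixed n (p : {mpoly N[n]}) :
  {in G, forall g, map_mpoly (aN g) p = p} -> exists p', map_mpoly iN p' = p.
Proof.
move=> fix_p; have /choice[c cE] : forall m, exists l, iN l = p@_m.
  by move=> m; apply: iN_fixed => g Gg; rewrite -mcoeff_map_mpoly fix_p.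
exists (\sum_(m <- msupp p) c m *: 'X_[m]).
rewrite rmorph_sum /= [RHS]mpolyE; apply: eq_bigr => m _.
by rewrite map_mpolyZ map_mpolyX cE.
Qed.

(** Multiply p and q by the other conjugates of q. The new denominator is a norm, hence invariant;
    the new numerator takes at t the value e times that norm, hence is invariant because t is
    generic. *)
Lemma specializes_descent n (t : 'I_n -> E) (tau : 'I_n -> F) e w :
  generic_over i' t ->
  {in G, forall g j, aE g (t j) = t j} -> {in G, forall g j, aF g (tau j) = tau j} ->
  {in G, forall g, aE g e = e} ->
  specializes i i' t tau e w -> specializes (i \o iN) (i' \o iN) t tau e w.
Proof.
move=> t_gen t_fix tau_fix e_fix [p [q [q0 eq wq]]].
have evE g P : g \in G -> mmap i' t (map_mpoly (aN g) P) = aE g (mmap i' t P).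
  move=> Gg; rewrite mmap_map_mpoly rmorph_mmap.
  by apply: eq_mmap => x /=; [rewrite i'_act | rewrite t_fix].
have evF g P : g \in G -> mmap i tau (map_mpoly (aN g) P) = aF g (mmap i tau P).
  move=> Gg; rewrite mmap_map_mpoly rmorph_mmap.
  by apply: eq_mmap => x /=; [rewrite i_act | rewrite tau_fix].
pose r := \prod_(g in G | g != 1%g) map_mpoly (aN g) q.
have qr : q * r = \prod_(g in G) map_mpoly (aN g) q.
  rewrite (bigD1 1%g) //=; congr (_ * _).
  by apply/mpolyP => m; rewrite mcoeff_map_mpoly /= aN1.
have qr_fix : {in G, forall g, map_mpoly (aN g) (q * r) = q * r}.
  move=> h Gh; rewrite qr rmorph_prod [RHS](reindex_inj (mulgI h)) /=.
  apply: eq_big => [g|g Gg]; first by rewrite groupMl.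
  by apply/mpolyP => m; rewrite !mcoeff_map_mpoly /= aNM.
have [q' q'E] := mpoly_fixed qr_fix.
have pr_fix : {in G, forall g, map_mpoly (aN g) (p * r) = p * r}.
  move=> h Gh; apply: (generic_inj t_gen); rewrite evE //.
  have -> : mmap i' t (p * r) = e * mmap i' t (q * r) by rewrite !rmorphM /= -eq mulrA.
  by rewrite rmorphM e_fix // -evE // qr_fix.
have [p' p'E] := mpoly_fixed pr_fix.
exists p', q'; rewrite -!(mmap_map_mpoly iN) p'E q'E !rmorphM /= !mulrA eq wq.
split=> //; rewrite -[_ * _](rmorphM (mmap i tau)) qr rmorph_prod prodf_seq_neq0.
by apply/allP => g _ /=; apply/implyP => Gg; rewrite evF // fmorph_eq0.
Qed.

End Descent.

(** * No-name lemma: invariant coordinates on a permutation module *)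

Section NoName.

Variables (gT : finGroupType) (G : {group gT}) (N E : fieldType).
Variables (aN : gT -> {rmorphism N -> N}) (aE : gT -> {rmorphism E -> E}).
Variable (i : {rmorphism N -> E}).
Hypothesis i_act : {in G, forall g x, i (aN g x) = aE g (i x)}.
Variables (p : nat) (pi : gT -> 'I_p -> 'I_p) (C : 'M[N]_p) (X : 'I_p -> E).
Hypothesis pi1 : forall j, pi 1%g j = j.
Hypothesis piM : {in G &, forall g h j, pi (g * h)%g j = pi g (pi h j)}.
Hypothesis C_unit : C \in unitmx.
Hypothesis C_fixed : {in G, forall g a j, aN g (C a j) = C a (pi g j)}.
Hypothesis X_perm : {in G, forall g j, aE g (X j) = X (pi g j)}.

Definition linear_change (a : 'I_p) : E := \sum_j i (C a j) * X j.

Lemma linear_change_fixed : {in G, forall g a, aE g (linear_change a) = linear_change a}.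
Proof.
move=> g Gg a; rewrite rmorph_sum [RHS](reindex_inj (h := pi g)) /=.
  by apply: eq_bigr => j _; rewrite rmorphM X_perm // -i_act // C_fixed.
by apply: (can_inj (g := pi g^-1%g)) => j; rewrite -piM ?groupV // mulVg pi1.
Qed.

Lemma linear_change_inv j : X j = \sum_a i (invmx C j a) * linear_change a.
Proof.
under eq_bigr => a _ do rewrite /linear_change mulr_sumr.
rewrite exchange_big (bigD1 j) //= [X in _ + X]big1 ?addr0 => [|l lj].
  have /matrixP/(_ j j) := mulVmx C_unit; rewrite !mxE eqxx => /(congr1 i).
  rewrite rmorph_sum /= rmorph1 => e; rewrite -[LHS]mul1r -e mulr_suml.
  by apply: eq_bigr => a _; rewrite rmorphM mulrA.
have /matrixP/(_ j l) := mulVmx C_unit; rewrite !mxE eq_sym (negPf lj) => /(congr1 i).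
rewrite rmorph_sum rmorph0 => /(congr1 ( *%R^~ (X l))); rewrite mul0r mulr_suml.
by move=> e; rewrite -[RHS]e; apply: eq_bigr => a _; rewrite rmorphM mulrA.
Qed.

Lemma linear_change_generic : generic_over i X -> generic_over i linear_change.
Proof.
move=> X_gen P P0.
pose T a : {mpoly N[p]} := \sum_j (C a j)%:MP * 'X_j.
pose U j : {mpoly N[p]} := \sum_a (invmx C j a)%:MP * 'X_a.
have PT : mmap (@mpolyC p N) T P = 0.
  apply: X_gen; rewrite rmorph_mmap -[RHS]P0; apply: eq_mmap => [c|a] /=.
    by rewrite mmap_mpolyC.
  rewrite /T rmorph_sum; apply: eq_bigr => j _.
  by rewrite rmorphM /= mmap_mpolyC mmap_mpolyX.
have : mmap (@mpolyC p N) U (mmap (@mpolyC p N) T P) = P.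
  rewrite rmorph_mmap [RHS](mpoly_morph_mmap idfun); apply: eq_mmap => [c|a] /=.
    by rewrite mmap_mpolyC.
  rewrite /T rmorph_sum /=.
  under eq_bigr => j _ do rewrite rmorphM /= mmap_mpolyC mmap_mpolyX /U mulr_sumr.
  rewrite exchange_big (bigD1 a) //= [X in _ + X]big1 ?addr0 => [|b ba].
    have /matrixP/(_ a a) := mulmxV C_unit; rewrite !mxE eqxx => /(congr1 (@mpolyC p N)).
    rewrite rmorph_sum /= rmorph1 => e; rewrite -[RHS]mul1r -e mulr_suml.
    by apply: eq_bigr => j _; rewrite rmorphM mulrA.
  have /matrixP/(_ a b) := mulmxV C_unit; rewrite !mxE eq_sym (negPf ba).
  move=> /(congr1 (@mpolyC p N)).
  rewrite rmorph_sum rmorph0 => /(congr1 ( *%R^~ 'X_b)); rewrite mul0r mulr_suml.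
  by move=> e; rewrite -[RHS]e; apply: eq_bigr => j _; rewrite rmorphM mulrA.
by rewrite PT rmorph0.
Qed.

End NoName.

(** * Permutation lattices, summands and flabby resolutions *)

Lemma col_mulmx (R : nzRingType) m n p (A : 'M[R]_(m, n)) (B : 'M_(n, p)) j :
  col j (A *m B) = A *m col j B.
Proof. by rewrite !colE mulmxA. Qed.

Section PermutationLattices.

Variables (gT : finGroupType) (G : {group gT}).

Definition index_action q (pi : gT -> 'I_q -> 'I_q) : Prop :=
  (forall j, pi 1%g j = j) /\
  {in G &, forall g h j, pi (g * h)%g j = pi g (pi h j)}.

Definition index_mx q (pi : gT -> 'I_q -> 'I_q) g : 'M[int]_q :=
  \matrix_(a, b) (a == pi g b)%:Z.

Lemma mul_index_mx q n (pi : gT -> 'I_q -> 'I_q) g (b : 'M[int]_(n, q)) j :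
  col j (b *m index_mx pi g) = col (pi g j) b.
Proof.
apply/matrixP => i l; rewrite !mxE (bigD1 (pi g j)) //= !mxE eqxx mulr1.
by rewrite big1 ?addr0 // => a /negPf aj; rewrite mxE aj mulr0.
Qed.

Lemma index_mx_repr q (pi : gT -> 'I_q -> 'I_q) :
  index_action pi -> mx_repr G (index_mx pi).
Proof.
move=> [pi1 piM]; split=> [|g h Gg Gh].
  by apply/matrixP => a b; rewrite !mxE pi1 natz.
apply/matrixP => a b.
have /matrixP/(_ a 0) := mul_index_mx pi h (index_mx pi g) b.
by rewrite mxE => ->; rewrite !mxE piM.
Qed.

Definition index_lattice q (pi : gT -> 'I_q -> 'I_q) (pi_act : index_action pi) :
    glattice G q :=
  MxRepresentation (index_mx_repr pi_act).

Definition lattice_summand m n (rM : glattice G m) (rN : glattice G n) : Prop :=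
  exists (a : 'M[int]_(n, m)) (b : 'M[int]_(m, n)),
    [/\ lattice_hom rM rN a, lattice_hom rN rM b & b *m a = 1%:M].

Lemma lattice_summand_trans m n l (rM : glattice G m) (rN : glattice G n)
    (rL : glattice G l) :
  lattice_summand rM rN -> lattice_summand rN rL -> lattice_summand rM rL.
Proof.
move=> [a [b [aP bP ba]]] [c [d [cP dP dc]]]; exists (c *m a), (b *m d); split.
- by move=> g Gg; rewrite -mulmxA aP // mulmxA cP // mulmxA.
- by move=> g Gg; rewrite -mulmxA dP // mulmxA bP // mulmxA.
by rewrite mulmxA -(mulmxA b) dc mulmx1.
Qed.

Lemma lattice_iso_summand m n (rM : glattice G m) (rN : glattice G n) :
  lattice_iso rM rN -> lattice_summand rM rN.
Proof.
move=> [u [v [uP uv vu]]]; exists u, v; split=> // g Gg.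
by rewrite -[LHS]mulmx1 -uv -!mulmxA (mulmxA _ u) -uP // !mulmxA vu mul1mx.
Qed.

Lemma lattice_summand_dsum m n (rM : glattice G m) (rN : glattice G n) :
  lattice_summand rM (lattice_dsum rM rN).
Proof.
exists (col_mx 1%:M 0), (row_mx 1%:M 0); split=> [g Gg|g Gg|].
- by rewrite mul_col_mx mul_block_col !mulmx0 !mul0mx !mulmx1 mul1mx !addr0.
- by rewrite mul_mx_row mul_row_block !mulmx0 !mul0mx !mulmx1 mul1mx !addr0.
by rewrite mul_row_col mulmx1 mulmx0 addr0.
Qed.

Lemma lattice_summand_dsuml m n l (rM : glattice G m) (rN : glattice G n)
    (rL : glattice G l) :
  lattice_summand rM rN ->
  lattice_summand (lattice_dsum rM rL) (lattice_dsum rN rL).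
Proof.
move=> [a [b [aP bP ba]]].
exists (block_mx a 0 0 1%:M), (block_mx b 0 0 1%:M); split=> [g Gg|g Gg|].
- by rewrite !mulmx_block !(mulmx0, mul0mx, mulmx1, mul1mx, addr0, add0r) aP.
- by rewrite !mulmx_block !(mulmx0, mul0mx, mulmx1, mul1mx, addr0, add0r) bP.
rewrite !mulmx_block !(mulmx0, mul0mx, mulmx1, mul1mx, addr0, add0r) ba.
by rewrite -scalar_mx_block.
Qed.

Lemma permutation_lattice_dsum m n (rM : glattice G m) (rN : glattice G n) :
  permutation_lattice rM -> permutation_lattice rN ->
  permutation_lattice (lattice_dsum rM rN).
Proof.
move=> [b b_unit bP] [c c_unit cP]; exists (block_mx b 0 0 c).
  by rewrite unitmxE det_ublock unitrM -!unitmxE b_unit.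
have colL l : col (lshift n l) (block_mx b 0 0 c) = col_mx (col l b) 0.
  by rewrite block_mxEh colKl colE mul_col_mx mul0mx -colE.
have colR l : col (rshift m l) (block_mx b 0 0 c) = col_mx 0 (col l c).
  by rewrite block_mxEh colKr colE mul_col_mx mul0mx -colE.
move=> g Gg j; case: (split_ordP j) => l ->.
  have [l' e] := bP g Gg l; exists (lshift n l').
  by rewrite !colL mul_block_col e !(mulmx0, mul0mx, addr0).
have [l' e] := cP g Gg l; exists (rshift m l').
by rewrite !colR mul_block_col e !(mulmx0, mul0mx, add0r).
Qed.

Lemma col_unit_inj q (b : 'M[int]_q) i j :
  b \in unitmx -> col i b = col j b -> i = j.
Proof.
move=> b_unit /(congr1 (mulmx (invmx b))); rewrite !colE !mulmxA mulVmx // !mul1mx.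
move=> /matrixP/(_ i 0); rewrite !mxE !eqxx; case: eqP => //.
Qed.

Lemma permutation_index_lattice q (rQ : glattice G q) :
  permutation_lattice rQ ->
  exists (pi : gT -> 'I_q -> 'I_q) (pi_act : index_action pi) (b : 'M[int]_q), b \in unitmx /\
    {in G, forall g, rQ g *m b = b *m index_lattice pi_act g}.
Proof.
move=> [b b_unit bP].
have /choice[pi piP] : forall g, exists f : 'I_q -> 'I_q,
    g \in G -> forall j, rQ g *m col j b = col (f j) b.
  move=> g; have [Gg|_] := boolP (g \in G); last by exists id.
  by have /choice[f fP] := bP g Gg; exists f.
have pi_act : index_action pi.
  split=> [j|g h Gg Gh j]; apply: (col_unit_inj b_unit).
    by rewrite -piP // repr_mx1 mul1mx.
  by rewrite -!piP ?groupM // repr_mxM // mulmxA.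
exists pi, pi_act, b; split=> // g Gg; apply/matrixP => i j.
have : col j (rQ g *m b) = col j (b *m index_mx pi g).
  by rewrite mul_index_mx -piP // !colE mulmxA.
by move=> /matrixP/(_ i 0); rewrite ![col _ _ _ _]mxE.
Qed.

Lemma permutation_index_summand q (rQ : glattice G q) :
  permutation_lattice rQ ->
  exists (pi : gT -> 'I_q -> 'I_q) (pi_act : index_action pi),
    lattice_summand rQ (index_lattice pi_act).
Proof.
move=> /permutation_index_lattice[pi [pi_act [b [b_unit bP]]]].
exists pi, pi_act, (invmx b), b; split=> [g Gg|g Gg|]; last exact: mulmxV.
  apply: (canRL (mulmxK b_unit)); rewrite -mulmxA bP // mulmxA.
  by rewrite mulVmx // mul1mx.
by rewrite bP.
Qed.

(** From F + Q1 = E + Q2 and E + E' = Q3, F is a summand of Q3 + Q2. The resolution splits over Z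
    since F is free, and all its maps are rewritten in the permuted basis b of P. *)
Lemma flabby_class_invertible_data m (rM : glattice G m) :
  flabby_class_invertible rM ->
  exists p (pi : gT -> 'I_p -> 'I_p) (pi_act : index_action pi) f (rF : glattice G f)
    q (pi' : gT -> 'I_q -> 'I_q) (pi'_act : index_action pi')
    (i : 'M[int]_(p, m)) (r : 'M[int]_(m, p))
    (e : 'M[int]_(f, p)) (s : 'M[int]_(p, f)),
  [/\ lattice_hom rM (index_lattice pi_act) i /\
      lattice_hom (index_lattice pi_act) rF e,
      [/\ e *m i = 0, e *m s = 1%:M, r *m i = 1%:M & i *m r + s *m e = 1%:M]
    & lattice_summand rF (index_lattice pi'_act)].
Proof.
move=> [p [rP [f [rF [d [rD [[permP _ [i [e [[iP eP] i_inj ei e_surj]]]] invD simFD]]]]]]].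
have [q1 [rQ1 [q2 [rQ2 [permQ1 permQ2 isoFD]]]]] := simFD.
have [d' [rD' [q3 [rQ3 [permQ3 isoD]]]]] := invD.
have [pi' [pi'_act sumQ]] :=
  permutation_index_summand (permutation_lattice_dsum permQ3 permQ2).
have sumF : lattice_summand rF (index_lattice pi'_act).
  apply: lattice_summand_trans (lattice_summand_dsum rF rQ1) _.
  apply: lattice_summand_trans (lattice_iso_summand isoFD) _.
  apply: lattice_summand_trans _ sumQ; apply: lattice_summand_dsuml.
  apply: lattice_summand_trans (lattice_summand_dsum rD rD') _.
  exact: lattice_iso_summand.
have [pi [pi_act [b [b_unit bP]]]] := permutation_index_lattice permP.
have ei0 : e *m i = 0.
  apply/matrixP => a c; have : e *m (i *m col c 1%:M) = 0 by apply/ei; exists (col c 1%:M).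
  by move=> /matrixP/(_ a 0); rewrite mulmxA -col_mulmx mulmx1 mxE [RHS]mxE => ->; rewrite mxE.
have [s es] : exists s, e *m s = 1%:M.
  have /choice[v vE] : forall c : 'I_f, exists v, col c 1%:M = e *m v.
    by move=> c; apply: e_surj.
  exists (\matrix_(a, c) v c a 0); apply/matrixP => a c.
  have /matrixP/(_ a 0) := vE c; rewrite [LHS]mxE => ->; rewrite !mxE.
  by apply: eq_bigr => l _; rewrite mxE.
have [r irse] : exists r, i *m r = 1%:M - s *m e.
  have /choice[v vE] : forall c : 'I_p, exists v, col c (1%:M - s *m e) = i *m v.
    by move=> c; apply/ei; rewrite -col_mulmx mulmxBr mulmx1 mulmxA es mul1mx subrr col0.
  exists (\matrix_(a, c) v c a 0); apply/matrixP => a c.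
  have /matrixP/(_ a 0) := vE c; rewrite [LHS]mxE => ->; rewrite !mxE.
  by apply: eq_bigr => l _; rewrite mxE.
have ri : r *m i = 1%:M.
  apply/matrixP => a c; have : col c (r *m i) = col c 1%:M.
    apply: i_inj; rewrite -!col_mulmx mulmx1 mulmxA irse mulmxBl mul1mx -mulmxA ei0.
    by rewrite mulmx0 subr0.
  by move=> /matrixP/(_ a 0); rewrite ![col _ _ _ _]mxE.
have bV : b *m invmx b = 1%:M by apply: mulmxV.
have Vb : invmx b *m b = 1%:M by apply: mulVmx.
exists p, pi, pi_act, f, rF, (q3 + q2)%N, pi', pi'_act.
exists (invmx b *m i), (r *m b), (e *m b), (invmx b *m s); split=> //.
  split=> g Gg; last by rewrite -mulmxA -bP // mulmxA eP // mulmxA.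
  rewrite -mulmxA iP //; apply: (canLR (mulKmx b_unit)).
  by rewrite mulmxA -[in RHS]mulmxA mulmxA -bP // -!mulmxA (mulmxA b) bV mul1mx.
split.
- by rewrite mulmxA -(mulmxA e) bV mulmx1.
- by rewrite mulmxA -(mulmxA e) bV mulmx1.
- by rewrite mulmxA -(mulmxA r) bV mulmx1.
have -> : invmx b *m i *m (r *m b) = 1%:M - invmx b *m s *m (e *m b).
  by rewrite mulmxA -(mulmxA _ i) irse mulmxBr mulmxBl mulmx1 Vb !mulmxA.
by rewrite subrK.
Qed.

End PermutationLattices.

(** * Embedding a lattice in a permutation lattice *)

Section InducedLattice.

Variables (gT : finGroupType) (G : {group gT}) (m : nat) (rM : glattice G m).

Local Notation index := ('I_m * subg_of G)%type.

Definition induced_index_action (g : gT) (a : 'I_#|{: index}|) : 'I_#|{: index}| :=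
  enum_rank ((enum_val a).1, (subg G g * (enum_val a).2)%g).

Lemma induced_index_actionP : index_action G induced_index_action.
Proof.
split=> [j|g h Gg Gh j]; rewrite /induced_index_action.
  rewrite (_ : subg G 1 = 1%g) ?mul1g; last by apply: val_inj; rewrite /= subgK.
  by rewrite -surjective_pairing enum_valK.
by rewrite enum_rankK /= subgM // mulgA.
Qed.

(* v |-> (g^-1 v)_g                                                           *)
Lemma permutation_embedding : exists p (pi : gT -> 'I_p -> 'I_p)
    (pi_act : index_action G pi) (u : 'M[int]_(p, m)) r,
  lattice_hom rM (index_lattice pi_act) u /\ r *m u = 1%:M.
Proof.
exists #|{: index}|, induced_index_action, induced_index_actionP.
pose u : 'M[int]_(#|{: index}|, m) :=
  \matrix_(a, j) rM (sgval (enum_val a).2)^-1%g (enum_val a).1 j.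
(* The left inverse reads off the component at 1. *)
exists u, (\matrix_(j, a) (a == enum_rank (j, 1%g))%:Z); split=> [g Gg|].
  apply/matrixP => a j; rewrite !mxE.
  pose a' := induced_index_action g^-1%g a.
  have a'K : a = induced_index_action g a'.
    rewrite /a'; case: induced_index_actionP => p1 pM.
    by rewrite -pM ?groupV // mulgV p1.
  rewrite (bigD1 a') //= [X in _ + X]big1 ?addr0 => [|b ba]; last first.
    rewrite !mxE a'K; case: eqP => [e|_]; last by rewrite mul0r.
    case: induced_index_actionP => p1 pM; case/eqP: ba.
    rewrite -[b]p1 -[a']p1 -(mulVg g) !pM ?groupV //; congr (induced_index_action _ _).
    exact/esym.
  rewrite !mxE -a'K eqxx mul1r /a' /induced_index_action enum_rankK /=.
  rewrite subgK ?groupV // invMg invgK repr_mxM ?groupV ?subgP //.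
  by rewrite mxE; apply: eq_bigr => b _; rewrite mxE.
apply/matrixP => i j; rewrite !mxE (bigD1 (enum_rank (i, 1%g))) //= !mxE eqxx mul1r.
rewrite enum_rankK /= invg1 repr_mx1 big1 ?addr0 ?mxE // => b /negPf bi.
by rewrite mxE bi mul0r.
Qed.

End InducedLattice.

(** * Function fields of direct sums *)

Section BlockMonomials.

Variables (k : fieldType) (n m l : nat).

Lemma monomials_inl (j : 'I_n) :
  monomials (@rfX k (n + m)) (col_mx 1%:M 0 : 'M_(n + m, n)) j = rfX k (lshift m j).
Proof.
apply: monomials_delta => i; case: (split_ordP i) => a ->.
  by rewrite col_mxEu mxE natz (inj_eq (@lshift_inj n m)).
by rewrite col_mxEd mxE eq_rlshift.
Qed.

Lemma monomials_inr (j : 'I_m) :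
  monomials (@rfX k (n + m)) (col_mx 0 1%:M : 'M_(n + m, m)) j = rfX k (rshift n j).
Proof.
apply: monomials_delta => i; case: (split_ordP i) => a ->.
  by rewrite col_mxEu mxE eq_lrshift.
by rewrite col_mxEd mxE natz (inj_eq (@rshift_inj n m)).
Qed.

Lemma monomials_down (v : 'M[int]_(m, l)) j :
  monomials (@rfX k (n + m)) (col_mx 0 v) j
    = monomials (fun i => rfX k (rshift n i)) v j.
Proof.
rewrite -(mulmx1 v) -[0](mul0mx _ v).
have -> : col_mx (0 *m v) (v *m 1%:M) = col_mx 0 1%:M *m v :> 'M[int]_(n + m, l).
  by rewrite mul_col_mx mul1mx mulmx1 mul0mx.
rewrite mulmx1 -monomials_comp; last exact: rfX_neq0.
by congr (monomials _ _ _); apply/funext => i; rewrite monomials_inr.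
Qed.

End BlockMonomials.

Section DirectSumFields.

Variables (k : fieldType) (gT : finGroupType) (G : {group gT}) (n m : nat).
Variables (rM : glattice G n) (rN : glattice G m).
Let rMN := lattice_dsum rM rN.

Lemma lattice_inl_hom : lattice_hom rM rMN (col_mx 1%:M 0).
Proof.
move=> g Gg; rewrite mul_col_mx mul_block_col.
by rewrite !(mulmx0, mul0mx, mulmx1, mul1mx, addr0).
Qed.

Lemma lattice_inr_hom : lattice_hom rN rMN (col_mx 0 1%:M).
Proof.
move=> g Gg; rewrite mul_col_mx mul_block_col.
by rewrite !(mulmx0, mul0mx, mulmx1, mul1mx, add0r).
Qed.

Lemma lattice_act_dsumr : {in G, forall g j,
  lattice_act k rMN g (rfX k (rshift n j))
    = monomials (fun i => rfX k (rshift n i)) (rN g) j}.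
Proof.
move=> g Gg j; rewrite lattice_actX // -monomials_down /monomials.
apply: eq_bigr => i _; congr (_ ^ _).
rewrite /= /dsum_mx block_mxEh row_mxEr; case: (split_ordP i) => a ->.
  by rewrite !col_mxEu.
by rewrite !col_mxEd.
Qed.

Lemma faithful_dsuml : mx_faithful rM -> mx_faithful rMN.
Proof.
move=> rM_faithful; apply/subsetP => g /rkerP[Gg gM].
apply: (subsetP rM_faithful); apply/rkerP; split=> //.
by have := congr1 ulsubmx gM; rewrite /= /dsum_mx block_mxKul scalar_mx_block block_mxKul.
Qed.

End DirectSumFields.

Lemma generic_comp (K K' : comNzRingType) (E : fieldType) n (f : {rmorphism K -> K'})
    (i' : {rmorphism K' -> E}) (t : 'I_n -> E) :
  injective f -> generic_over i' t -> generic_over (i' \o f) t.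
Proof.
move=> f_inj t_gen p; rewrite -mmap_map_mpoly => /t_gen p0.
by apply: (map_mpoly_inj f_inj); rewrite p0 rmorph0.
Qed.

Lemma invariant_index_basis (gT : finGroupType) (G : {group gT}) (N : fieldType)
    (act : gT -> {rmorphism N -> N}) p (pi : gT -> 'I_p -> 'I_p) :
  faithful_field_action G act -> @index_action _ G p pi ->
  exists2 C : 'M[N]_p, C \in unitmx &
    {in G, forall g a j, act g (C a j) = C a (pi g j)}.
Proof.
move=> act_f [pi1 piM].
have [||C C_unit fixC] := twisted_fixed_basis act_f pi1 piM (w := fun _ _ => 1).
- by move=> g _ j; rewrite oner_neq0.
- by move=> g h _ _ j; rewrite rmorph1 mulr1.
by exists C => // g Gg a j; rewrite fixC // mul1r.
Qed.

Section FixedFields.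

Variables (k : fieldType) (gT : finGroupType) (G : {group gT}) (n : nat).
Variable rM : glattice G n.

Lemma fixed_fieldP (x : ratfun k n) :
  {in G, forall g, lattice_act k rM g x = x} ->
  exists l : fixed_field (lattice_action k rM), val l = x.
Proof. by move=> /lattice_fixedP fx; exists (FixedField fx). Qed.

Lemma fixed_field_act (l : fixed_field (lattice_action k rM)) :
  {in G, forall g, lattice_act k rM g (val l) = val l}.
Proof. by apply/lattice_fixedP; case: l. Qed.

End FixedFields.

(** * Transfer of residue sections through A + M *)

Section SumWithInvertible.

Variables (k : fieldType) (k_infinite : infinite_field k).
Variables (gT : finGroupType) (G : {group gT}) (n m : nat).
Variables (rA : glattice G n) (rM : glattice G m).
Hypothesis A_faithful : mx_faithful rA.

Lemma residue_section_dsum :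
  flabby_class_invertible rM ->
  residue_section (fixedC (lattice_action k rA)) ->
  residue_section (fixedC (lattice_action k (lattice_dsum rA rM))).
Proof.
move=> /flabby_class_invertible_data[p [pi [pi_act [f [rF [q [pi' [pi'_act]]]]]]]].
move=> [i [r [e [s [[iP eP] [ei es ri irse] [alpha [beta [alphaP betaP ba]]]]]]]].
have [pi1 piM] := pi_act; have [pi'1 pi'M] := pi'_act.
set rP := index_lattice pi_act in iP eP.
set rAM := lattice_dsum rA rM; set rAP := lattice_dsum rA rP.
have actA := lattice_act_faithful k A_faithful.
have actAM := lattice_act_faithful k (faithful_dsuml rM A_faithful).
have row_col l : (row_mx 1%:M 0 : 'M_(n, n + l)) *m col_mx 1%:M 0 = 1%:M :> 'M[int]_n.
  by rewrite mul_row_col mulmx1 mulmx0 addr0.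
have [iotaM [iMC iMX]] := lattice_map_exists k (row_col m).
have [iotaP [iPC iPX]] := lattice_map_exists k (row_col p).
have iM_act := lattice_map_act (lattice_inl_hom rA rM) iMC iMX.
have iP_act := lattice_map_act (lattice_inl_hom rA rP) iPC iPX.
have iPX' j : iotaP (rfX k j) = rfX k (lshift p j) by rewrite iPX monomials_inl.
have iMX' j : iotaM (rfX k j) = rfX k (lshift m j) by rewrite iMX monomials_inl.
have ri1 : block_mx 1%:M 0 0 r *m block_mx 1%:M 0 0 i = 1%:M :> 'M[int]_(n + m).
  rewrite mulmx_block !(mulmx0, mul0mx, mulmx1, mul1mx, addr0, add0r) ri.
  by rewrite -scalar_mx_block.
have [sigma [sC sX]] := lattice_map_exists k ri1.
have s_hom : lattice_hom rAM rAP (block_mx 1%:M 0 0 i).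
  move=> g Gg; rewrite !mulmx_block.
  by rewrite !(mulmx0, mul0mx, mulmx1, mul1mx, addr0, add0r) iP.
have s_act := lattice_map_act s_hom sC sX.
have s_iota x : sigma (iotaM x) = iotaP x.
  apply: (eq_ratfun_hom (f := sigma \o iotaM) (g := iotaP)) => [c|j] /=.
    by rewrite iMC sC iPC.
  rewrite iMX (lattice_map_monomials _ sX) iPX; congr (monomials _ _ _).
  by rewrite mul_block_col !(mulmx0, mul0mx, mulmx1, mul1mx, addr0, add0r).
have sXr j : sigma (rfX k (rshift n j)) = monomials (fun a => rfX k (rshift n a)) i j.
  rewrite sX -monomials_down; apply: eq_bigr => a _; congr (_ ^ _).
  rewrite block_mxEh row_mxEr; case: (split_ordP a) => b ->; by rewrite ?col_mxEu ?col_mxEd.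
(* The equivariant extension h : P -> k(A + M)^* of the inclusion of M. *)
have [|h [h0 h_act hi]] := extend_equivariant actAM (iF := @rfC k (n + m)) k_infinite
   _ iP eP ei es ri irse pi'1 pi'M alphaP betaP ba (phi := fun j => rfX k (rshift n j))
   (fun _ => rfX_neq0 _ _) (lattice_act_dsumr k rA rM).
  by move=> g Gg c; rewrite lattice_actC.
have h_perm : {in G, forall g j, lattice_act k rAM g (h j) = h (pi g j)}.
  move=> g Gg j; rewrite h_act //; apply: monomials_delta => a; by rewrite mxE.
pose X (j : 'I_p) : ratfun k (n + p) := rfX k (rshift n j).
have X_perm : {in G, forall g j, lattice_act k rAP g (X j) = X (pi g j)}.
  move=> g Gg j; rewrite lattice_act_dsumr //.
  by apply: (monomials_delta X) => a; rewrite mxE.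
have [C C_unit C_fix] := invariant_index_basis actA pi_act.
have X_gen := rfX_block_generic iPC iPX'.
(* The same matrix C over k(A) is applied to X and to h, so that setting t = tau sends X to h, and
   sigma(z) to z. *)
pose t := linear_change iotaP C X; pose tau := linear_change iotaM C h.
have t_gen : generic_over iotaP t by apply: linear_change_generic.
have t_fix := linear_change_fixed iP_act pi1 piM C_fix X_perm.
have tau_fix := linear_change_fixed iM_act pi1 piM C_fix h_perm.
have spec_X j : specializes iotaM iotaP t tau (X j) (h j).
  rewrite (linear_change_inv iotaP X C_unit) (linear_change_inv iotaM h C_unit).
  apply: spec_sum => a; apply: specM; [exact: spec_const | exact: spec_var].
have spec_s z : specializes iotaM iotaP t tau (sigma z) z.
  apply: (spec_ratfun (f := sigma) (g := idfun) t_gen) => [c|j] /=.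
    by rewrite -iMC s_iota; exact: spec_const.
  case: (split_ordP j) => l ->.
    by rewrite -iMX' s_iota; exact: spec_const.
  rewrite sXr -[X in specializes _ _ _ _ _ X](congr1 (@^~ l) hi).
  by apply: spec_prod => a; exact: (specXz t_gen (i a l) (h0 a) (spec_X a)).
have [nu [nuE nuC]] := lattice_map_fixed (lattice_inl_hom rA rM) iMC iMX.
move=> secA.
have -> : fixedC (lattice_action k rAM) = nu \o fixedC (lattice_action k rA).
  by apply/funext => c /=; rewrite nuC.
have /choice[T TE] a : exists l : fixed_field (lattice_action k rAM), val l = tau a.
  by apply: fixed_fieldP => g Gg; apply: tau_fix.
pose sigma' : {rmorphism fixed_field (lattice_action k rAM) -> ratfun k (n + p)} :=
  sigma \o val.
have sn l : (sigma' \o nu) l = (iotaP \o val) l by rewrite /= nuE s_iota.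
apply: (residue_section_trans (sigma := sigma') (t := t) (tau := T)) secA.
  move=> P; rewrite (eq_mmap sn (fun _ => erefl)).
  by apply: (generic_comp (f := val)); [exact: val_inj | exact: t_gen].
have [actA1 actAM' _] := actA.
move=> z; have z_fix := fixed_field_act z.
have [p' [q'' [q0 eq wq]]] := specializes_descent actA1 actAM' iM_act iP_act
  (@fixed_fieldP _ _ _ _ rA) t_gen t_fix tau_fix (e := sigma (val z))
  (fun g Gg => etrans (esym (s_act g Gg _)) (congr1 sigma (z_fix g Gg))) (spec_s (val z)).
have nuT P : val (mmap nu T P) = mmap (iotaM \o val) tau P.
  by rewrite rmorph_mmap; apply: eq_mmap => x /=; rewrite ?nuE ?TE.
exists p', q''; split.
- by apply: contra_neq q0; rewrite -nuT => ->; rewrite rmorph0.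
- by rewrite !(eq_mmap sn (fun _ => erefl)).
by apply: val_inj; rewrite rmorphM /= !nuT.
Qed.

End SumWithInvertible.

Section SpecializeSummand.

Variables (k : fieldType) (k_infinite : infinite_field k).
Variables (gT : finGroupType) (G : {group gT}) (m n : nat).
Variables (rA : glattice G m) (rM : glattice G n).
Hypothesis M_faithful : mx_faithful rM.

Lemma residue_section_of_dsum :
  residue_section (fixedC (lattice_action k (lattice_dsum rA rM))) ->
  residue_section (fixedC (lattice_action k rM)).
Proof.
have [p [pi [pi_act [i [r [iP ri]]]]]] := permutation_embedding rA.
set rP := index_lattice pi_act in iP.
have [pi1 piM] := pi_act.
set rAM := lattice_dsum rA rM; set rMP := lattice_dsum rM rP.
have actM := lattice_act_faithful k M_faithful.
have inl1 : (row_mx 1%:M 0 : 'M_(n, n + p)) *m col_mx 1%:M 0 = 1%:M :> 'M[int]_n.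
  by rewrite mul_row_col mulmx1 mulmx0 addr0.
have inr1 : (row_mx 0 1%:M : 'M_(n, m + n)) *m col_mx 0 1%:M = 1%:M :> 'M[int]_n.
  by rewrite mul_row_col mulmx1 mulmx0 add0r.
have [iota [iC iX]] := lattice_map_exists k inl1.
have [mu [muC muX]] := lattice_map_exists k inr1.
have i_act := lattice_map_act (lattice_inl_hom rM rP) iC iX.
have iX' j : iota (rfX k j) = rfX k (lshift p j) by rewrite iX monomials_inl.
have si1 : block_mx 0 r 1%:M 0 *m block_mx 0 1%:M i 0 = 1%:M :> 'M[int]_(m + n).
  rewrite mulmx_block !(mulmx0, mul0mx, mulmx1, mul1mx, addr0, add0r) ri.
  by rewrite -scalar_mx_block.
(* A + M is mapped to M + P by swapping the summands and embedding A in P. *)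
have [sigma [sC sX]] := lattice_map_exists k si1.
have s_hom : lattice_hom rAM rMP (block_mx 0 1%:M i 0).
  move=> g Gg; rewrite !mulmx_block.
  by rewrite !(mulmx0, mul0mx, mulmx1, mul1mx, addr0, add0r) iP.
have s_act := lattice_map_act s_hom sC sX.
have s_mu x : sigma (mu x) = iota x.
  apply: (eq_ratfun_hom (f := sigma \o mu) (g := iota)) => [c|j] /=.
    by rewrite muC sC iC.
  rewrite muX (lattice_map_monomials _ sX) iX; congr (monomials _ _ _).
  by rewrite mul_block_col !(mulmx0, mul0mx, mulmx1, mul1mx, addr0, add0r).
pose X (j : 'I_p) : ratfun k (n + p) := rfX k (rshift n j).
have X_perm : {in G, forall g j, lattice_act k rMP g (X j) = X (pi g j)}.
  move=> g Gg j; rewrite lattice_act_dsumr //.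
  by apply: (monomials_delta X) => a; rewrite mxE.
have [C C_unit C_fix] := invariant_index_basis actM pi_act.
have X_gen := rfX_block_generic iC iX'.
pose t := linear_change iota C X.
have t_gen : generic_over iota t by apply: linear_change_generic.
have t_fix := linear_change_fixed i_act pi1 piM C_fix X_perm.
(* With t as the point too, this only expresses z as a fraction in t over k(M). *)
have spec_E z : specializes iota iota t t z z.
  apply: (spec_ratfun (f := idfun) (g := idfun) t_gen) => [c|j] /=.
    by rewrite -iC; exact: spec_const.
  case: (split_ordP j) => l ->; first by rewrite -iX'; exact: spec_const.
  rewrite -/(X l) (linear_change_inv iota X C_unit).
  by apply: spec_sum => a; apply: specM; [exact: spec_const | exact: spec_var].
have [nu [nuE nuC]] := lattice_map_fixed (lattice_inr_hom rA rM) muC muX.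
have -> : fixedC (lattice_action k rAM) = nu \o fixedC (lattice_action k rM).
  by apply/funext => c /=; rewrite nuC.
pose sigma' : {rmorphism fixed_field (lattice_action k rAM) -> ratfun k (n + p)} :=
  sigma \o val.
have sn l : (sigma' \o nu) l = (iota \o val) l by rewrite /= nuE s_mu.
apply: (residue_section_specialize (sigma := sigma') (t := t) k_infinite).
  move=> P; rewrite (eq_mmap sn (fun _ => erefl)).
  by apply: (generic_comp (f := val)); [exact: val_inj | exact: t_gen].
have [actM1 actMM _] := actM.
move=> z; have z_fix := fixed_field_act z.
have [a [b [b0 ab _]]] := specializes_descent actM1 actMM i_act i_act
  (@fixed_fieldP _ _ _ _ rM) t_gen t_fix t_fix (e := sigma (val z))
  (fun g Gg => etrans (esym (s_act g Gg _)) (congr1 sigma (z_fix g Gg))) (spec_E _).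
exists a, b; rewrite !(eq_mmap sn (fun _ => erefl)); split=> //.
by apply: contra_neq b0 => ->; rewrite rmorph0.
Qed.

End SpecializeSummand.

Lemma retract_rational_lattice_transfer (k : fieldType) (gT : finGroupType)
    (G : {group gT}) n m (rA : glattice G n) (rM : glattice G m) :
  infinite_field k -> mx_faithful rA -> mx_faithful rM ->
  flabby_class_invertible rM ->
  retract_rational_lattice k rA -> retract_rational_lattice k rM.
Proof.
move=> k_inf A_faithful M_faithful M_inv /retract_rational_section A_rr.
apply: section_retract_rational; apply: (residue_section_of_dsum k_inf M_faithful).
exact: (residue_section_dsum k_inf A_faithful M_inv A_rr).
Qed.

(** * The regular lattice and the cycle of implications *)

Section RegularLattice.

Variables (gT : finGroupType) (G : {group gT}).

Definition regular_index_action (g : gT) (j : 'I_#|G|) : 'I_#|G| :=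
  gring_index G (g * enum_val j)%g.

Lemma regular_index_actionP : index_action G regular_index_action.
Proof.
split=> [j|g h Gg Gh j]; rewrite /regular_index_action.
  by rewrite mul1g gring_valK.
by rewrite gring_indexK ?groupM ?enum_valP // mulgA.
Qed.

Definition regular_lattice : glattice G #|G| := index_lattice regular_index_actionP.

Lemma index_lattice_permutation q (pi : gT -> 'I_q -> 'I_q) (pi_act : index_action G pi) :
  permutation_lattice (index_lattice pi_act).
Proof.
exists 1%:M; rewrite ?unitmx1 // => g Gg j; exists (pi g j).
by rewrite -col_mulmx mulmx1 -(mul_index_mx pi g 1%:M j) mul1mx.
Qed.

Lemma regular_lattice_faithful : mx_faithful regular_lattice.
Proof.
apply/subsetP => g /rkerP[Gg /matrixP g1]; apply/set1P.
have := g1 (gring_index G 1%g) (gring_index G 1%g); rewrite !mxE eqxx.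
rewrite /regular_index_action gring_indexK // mulg1; case: eqP => // e _.
by have := congr1 enum_val e; rewrite !gring_indexK.
Qed.

Lemma permutation_flabby_class_invertible n (rM : glattice G n) :
  permutation_lattice rM -> flabby_class_invertible rM.
Proof.
move=> permM.
have id_act : @index_action _ G 0 (fun _ j => j) by [].
pose r0 := index_lattice id_act.
have iso0 : lattice_iso (lattice_dsum r0 r0) r0.
  exists 0, 0; split=> [g _||]; last 2 first.
  - by apply/matrixP => -[].
  - by apply/matrixP => -[].
  by rewrite mul0mx mulmx0.
have perm0 : permutation_lattice r0 by apply: index_lattice_permutation.
exists n, rM, 0, r0, 0, r0; split.
- split=> //.
    move=> H v _ _; exists (fun _ => 0); by apply/matrixP => -[].
  exists 1%:M, 0; split.
  + by split=> g _; rewrite ?mulmx1 ?mul1mx ?mul0mx ?mulmx0.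
  + by move=> v w /=; rewrite !mul1mx.
  + by move=> v; split=> _; [exists v; rewrite mul1mx | rewrite mul0mx].
  by move=> w; exists 0; apply/matrixP => -[].
- by exists 0, r0, 0, r0.
exists 0, r0, 0, r0; split=> //.
by exists 1%:M, 1%:M; split; rewrite ?mulmx1 // => g _; rewrite mulmx1 mul1mx.
Qed.

(** The axioms of an action are propositions, so proof irrelevance applies. Equality of the records
    is what allows rewriting in the types of fixed fields. *)
Lemma eq_rf_action (k : fieldType) n (a b : rf_action G k n) :
  rf_image a = rf_image b -> a = b.
Proof.
case: a b => f a1 a2 a3 [h b1 b2 b3] /= fh; subst h.
by congr RfAction; exact: Prop_irrelevance.
Qed.

Lemma regular_retract_rational (k : fieldType) :
  retract_rational_regular k G <-> retract_rational_lattice k regular_lattice.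
Proof.
suff e : regular_action k G = lattice_action k regular_lattice.
  by rewrite /retract_rational_regular /retract_rational_lattice e.
have : @regular_image k gT G = lattice_image k regular_lattice.
  apply/funext => h; apply/funext => j; rewrite /lattice_image.
  rewrite [RHS](_ : _ = monomials (@rfX k _) (regular_lattice h) j); last first.
    by apply: eq_bigr => i _; rewrite mxE.
  by apply/esym/monomials_delta => i; rewrite mxE.
exact: (@eq_rf_action _ _ (regular_action k G) (lattice_action k regular_lattice)).
Qed.

End RegularLattice.

Theorem theorem5p4 (k : fieldType) (k_infinite : infinite_field k)
    (gT : finGroupType) (G : {group gT}) :
  [<-> retract_rational_regular k G;
       exists (n : nat) (M : glattice G n),
         [/\ mx_faithful M, permutation_lattice M
           & retract_rational_lattice k M];
       exists (n : nat) (M : glattice G n),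
         [/\ mx_faithful M, flabby_class_invertible M
           & retract_rational_lattice k M];
       forall (n : nat) (M : glattice G n),
         mx_faithful M -> permutation_lattice M ->
         retract_rational_lattice k M;
       forall (n : nat) (M : glattice G n),
         mx_faithful M -> flabby_class_invertible M ->
         retract_rational_lattice k M;
       exists (n : nat) (M : glattice G n),
         mx_faithful M /\ retract_rational_lattice k M].
Proof.
have reg_f := regular_lattice_faithful G.
have reg_perm : permutation_lattice (regular_lattice G) by apply: index_lattice_permutation.
have reg_inv := permutation_flabby_class_invertible reg_perm.
tfae.
- by move=> /regular_retract_rational reg_rr; exists #|G|, (regular_lattice G).
- move=> [n [M [M_f M_perm M_rr]]]; exists n, M; split=> //.
  exact: permutation_flabby_class_invertible.
- move=> [n [A [A_f _ A_rr]]] m M M_f M_perm.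
  apply: retract_rational_lattice_transfer A_rr => //.
  exact: permutation_flabby_class_invertible.
- move=> all_perm m M M_f M_inv.
  apply: (retract_rational_lattice_transfer k_infinite reg_f) => //.
  exact: all_perm.
- by move=> all_inv; exists #|G|, (regular_lattice G); split=> //; apply: all_inv.
move=> [n [A [A_f A_rr]]]; apply/regular_retract_rational.
exact: retract_rational_lattice_transfer A_rr.
Qed.
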